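(* Let $n\ge2$. Suppose every component $f_i:\mathbb{R}^d\to\mathbb{R}$ is convex and differentiable with $L$-Lipschitz gradient, the average $F=\frac1n\sum_{i=1}^n f_i$ is $\mu$-strongly convex with $0<\mu\le L$ and unique minimizer $x_\star$, and, for some $\nu\in[\frac12,1]$ and $\rho_\nu\ge0$, $F$ is twice differentiable with $\|\nabla^2F(u)-\nabla^2F(v)\|_{\mathrm{op}}\le\rho_\nu\|u-v\|^\nu$ for all $u,v$. Fix $\zeta>4$, put $\kappa=L/\mu$, $q_0=\zeta\kappa$, $q_k=q_0+nk$, and run random reshuffling with the stepsizes $\eta_{0,i}=\frac{2\zeta}{\mu(q_0+i)}$ and $\eta_{k,i}=\frac{2\zeta}{\mu q_{k+1}}$ for $k\ge1$ ($i=1,\dots,n$). Assume there is a compact set $\mathcal X\subset\mathbb{R}^d$ containing $x_\star$ and every iterate $x_{k,i}$ of this run, uniformly over all epochs, inner positions and realizations of the permutations, and let $\bar G:=\max_{j}\sup_{z\in\mathcal X}\|\nabla f_j(z)\|<\infty$. Then $$ \mathbb{E}\|y_K-x_\star\|^2=O\left(\left(\frac{q_0}{q_K}\right)^{\zeta}\|y_0-x_\star\|^2+q_K^{-2}+n^2q_K^{-3}\right)\qquad(K\ge1). $$ If in addition $T=nK\ge q_0$, then $$ \mathbb{E}[F(y_K)-F(x_\star)]=O\left(T^{-2}+n^2T^{-3}\right). $$ Thus, when $n\ge c\kappa$ for a constant $c>0$, the latter bound already applies after a constant number of epochs (for every $K\ge\zeta/c$).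
   Context: Random reshuffling (RR) with stepsizes $\eta_{k,i}$ starts from a deterministic point $y_0\in\mathbb{R}^d$. At each epoch $k=0,1,2,\dots$ it draws a fresh, independent, uniformly random permutation $\pi_k$ of $\{1,\dots,n\}$, sets $x_{k,0}=y_k$, performs $x_{k,i}=x_{k,i-1}-\eta_{k,i}\nabla f_{\pi_k(i)}(x_{k,i-1})$ for $i=1,\dots,n$, and sets $y_{k+1}=x_{k,n}$. Expectations are over the permutations. In the first bound, the constant in $O(\cdot)$ depends only on $\zeta,L,\mu,\rho_\nu,\nu,\bar G$; in the second it may also depend on the initial distance $\|y_0-x_\star\|$. In both cases it is independent of $n$ and $K$. *)

(* Defs.v *)
From HB Require Import structures.
From mathcomp Require Import all_boot all_order all_algebra perm.
From mathcomp Require Import all_classical all_reals all_analysis.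

Set Implicit Arguments.
Unset Strict Implicit.
Unset Printing Implicit Defensive.

Import Order.TTheory GRing.Theory Num.Theory.
Import numFieldNormedType.Exports.

Local Open Scope classical_set_scope.
Local Open Scope ring_scope.

(* R^d is 'rV[R]_d. Its library norm is the sup norm, which is used only through
   the topology it induces (compactness, differentiability); every metric
   quantity is expressed with the Euclidean norm below. *)
Definition enorm (R : realType) (d : nat) (x : 'rV[R]_d) : R :=
  Num.sqrt (\sum_(j < d) x ord0 j ^+ 2).

Definition opnorm (R : realType) (d : nat) (A : 'M[R]_d) : R :=
  sup [set enorm (v *m A) | v in [set v : 'rV[R]_d | enorm v <= 1]].

Definition grad (R : realType) (d : nat) (f : 'rV[R]_d -> R) (x : 'rV[R]_d) :
    'rV[R]_d :=
  \row_(j < d) 'D_(delta_mx ord0 j) f x.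

Definition hessian (R : realType) (d : nat) (f : 'rV[R]_d -> R)
    (x : 'rV[R]_d) : 'M[R]_d :=
  'J (grad f) x.

Definition differentiable_everywhere (R : realType) (V W : normedModType R)
    (f : V -> W) : Prop :=
  forall x : V, differentiable f x.

Definition twice_differentiable (R : realType) (d : nat)
    (f : 'rV[R]_d -> R) : Prop :=
  differentiable_everywhere f /\ differentiable_everywhere (grad f).

Definition lipschitz_grad (R : realType) (d : nat) (L : R)
    (f : 'rV[R]_d -> R) : Prop :=
  forall x y : 'rV[R]_d, enorm (grad f x - grad f y) <= L * enorm (x - y).

Definition strongly_convex (R : realType) (d : nat) (mu : R)
    (f : 'rV[R]_d -> R) : Prop :=
  forall (t : R) (x y : 'rV[R]_d), 0 <= t <= 1 ->
    f (t *: x + (1 - t) *: y) <=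
    t * f x + (1 - t) * f y - mu / 2 * t * (1 - t) * enorm (x - y) ^+ 2.

Definition holder_hessian (R : realType) (d : nat) (rho nu : R)
    (f : 'rV[R]_d -> R) : Prop :=
  forall u v : 'rV[R]_d,
    opnorm (hessian f u - hessian f v) <= rho * enorm (u - v) `^ nu.

Definition minimizer (R : realType) (d : nat) (f : 'rV[R]_d -> R)
    (x : 'rV[R]_d) : Prop :=
  forall z : 'rV[R]_d, f x <= f z.

Definition unique_minimizer (R : realType) (d : nat) (f : 'rV[R]_d -> R)
    (x : 'rV[R]_d) : Prop :=
  minimizer f x /\ forall z : 'rV[R]_d, minimizer f z -> z = x.

Definition average (R : realType) (d n : nat) (f : 'I_n -> 'rV[R]_d -> R)
    (x : 'rV[R]_d) : R :=
  n%:R^-1 * \sum_(i < n) f i x.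

(* The default 0 of the maximum is harmless: all the suprema are nonnegative. *)
Definition max_grad_norm (R : realType) (d n : nat) (f : 'I_n -> 'rV[R]_d -> R)
    (X : set 'rV[R]_d) : R :=
  \big[Num.max/0]_(j < n) sup [set enorm (grad (f j) z) | z in X].

Definition rr_q (R : realType) (n : nat) (q0 : R) (k : nat) : R :=
  q0 + (n * k)%:R.

(* The inner position i ranges over 1, ..., n. *)
Definition rr_step (R : realType) (n : nat) (zeta mu q0 : R) (k i : nat) : R :=
  if k == 0%N then 2 * zeta / (mu * (q0 + i%:R))
  else 2 * zeta / (mu * rr_q n q0 k.+1).

Section iid_permutations.
Context d (Omega : measurableType d) (R : realType) (P : probability Omega R).
Context (n : nat) (pi : nat -> Omega -> 'S_n).

Definition permutation_rv : Prop :=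
  forall (k : nat) (s : 'S_n), measurable [set w | pi k w = s].

Definition uniform_permutations : Prop :=
  forall (k : nat) (s : 'S_n), P [set w | pi k w = s] = ((n`!)%:R^-1)%:E.

Definition independent_permutations : Prop :=
  forall (I : seq nat) (A : nat -> {set 'S_n}), uniq I ->
    P [set w | forall k, k \in I -> pi k w \in A k] =
    (\prod_(k <- I) P [set w | pi k w \in A k])%E.

Definition iid_uniform_permutations : Prop :=
  [/\ permutation_rv, uniform_permutations & independent_permutations].
End iid_permutations.

(* x k i w is x_{k,i} and y k w is y_k, at the realization w; step
   i.+1 of an epoch uses the component pi k w i, since 'I_n starts at 0.
   Values x k i w with i > n are irrelevant and left unconstrained. *)
Definition rr_run (R : realType) (d n : nat) (Omega : Type)
    (f : 'I_n -> 'rV[R]_d -> R) (eta : nat -> nat -> R)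
    (pi : nat -> Omega -> 'S_n) (y0 : 'rV[R]_d)
    (x : nat -> nat -> Omega -> 'rV[R]_d) (y : nat -> Omega -> 'rV[R]_d) :
    Prop :=
  forall w : Omega,
  [/\ y 0%N w = y0,
      forall k, x k 0%N w = y k w,
      forall k (i : 'I_n),
        x k i.+1 w = x k i w - eta k i.+1 *: grad (f (pi k w i)) (x k i w)
    & forall k, y k.+1 w = x k n w].

(* Main.v *)
Require Import Defs.
From HB Require Import structures.
From mathcomp Require Import all_boot all_order all_algebra perm.
From mathcomp Require Import all_classical all_reals all_analysis.
From mathcomp Require Import measurable_realfun ring lra.

Set Implicit Arguments.
Unset Strict Implicit.
Unset Printing Implicit Defensive.

Import Order.TTheory GRing.Theory Num.Theory.
Import numFieldNormedType.Exports.

Local Open Scope classical_set_scope.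
Local Open Scope ring_scope.

(* Three regimes are combined, with g_j the gradient of f_j at the minimizer T
   and u = x - T.

   First epoch, up to step m = floor(mu n / (4L)): the unseen components are
   exchangeable, so the mean of grad f_{pi(i)}(x_{i-1}) is n grad F minus the
   gradients already used, divided by the number n - i + 1 of unseen ones. The
   latter are a small fraction of the strong monotonicity of F plus the partial
   sum of the g_j, whose variance is linear. This gives the usual stochastic
   gradient recursion, hence (q0/q)^zeta |u|^2 + 1/q at step m.

   Remaining steps of the first epoch, and the boundedly many epochs in which
   n eta is not small: Gronwall's inequality costs a constant factor, and the
   partial sums of the g_j have variance O(n), by sampling without replacement.

   Later epochs: expanding grad F(x_i) at the start y of the epoch, the bias
   <u, E sum_i grad f_{pi(i)}(x_{i-1})> differs from n <u, grad F(y)> by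
   n |u| O(n eta |u| + eta + n eta^(3/2)). The O(eta) comes from exchanging two
   positions of the permutation, which moves the iterates by O(eta). The
   remainder of the Hoelder Hessian is of order |x_i - y|^(1 + nu), where
   |x_i - y| has random part O(eta sqrt n), and nu >= 1/2 makes this
   O(n eta^(3/2)). So
   E|u+|^2 <= (1 - n eta mu) |u|^2 + O(n eta^3 + n^3 eta^4),
   which sums to q^-2 + n^2 q^-3. *)

(** * Euclidean space *)

(** Why the regimes are cut this way. Over the whole first epoch the stepsizes sum to order log n,
    so a Gronwall bound there would lose a power of n. After step m every stepsize is O(1/n), and
    the remaining steps cost a factor independent of n. The noise 1/q left by the warm-up is
    affordable because q_1 <= (q0 + 1) n, which makes it O(n^2 q_1^-3); the noise n eta^2 of a
    coarse epoch is paid in the same way, q_k being O(n) for bounded k. Since n eta_k <= 2 zeta /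
    (mu (k + 1)), the epoch from which n eta is small enough does not depend on n. The factor 2 in
    the stepsizes lets 1 - 2 zeta n / q_{k+1} be at most (q_k / q_{k+1})^zeta even when n is as
    large as q_k. Given its starting point, an epoch is a function of one permutation, so all
    one-epoch estimates are finite averages over ['S_n]. Measure theory enters only through the law
    of the finite list of past permutations. *)

Section EuclideanSpace.
Context (R : realType) (d : nat).
Implicit Types (u v w x : 'rV[R]_d) (a : R).

(** Written as a matrix product so that transposition gives the adjoint identity [dotv_mulmx]. *)
Definition dotv u v : R := (u *m v^T) ord0 ord0.

Lemma dotvE u v : dotv u v = \sum_(j < d) u ord0 j * v ord0 j.
Proof. by rewrite /dotv mxE; apply: eq_bigr => j _; rewrite mxE. Qed.

Lemma dotvC u v : dotv u v = dotv v u.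
Proof. by rewrite !dotvE; apply: eq_bigr => j _; rewrite mulrC. Qed.

Lemma dotvDl u v w : dotv (u + v) w = dotv u w + dotv v w.
Proof. by rewrite /dotv mulmxDl mxE. Qed.

Lemma dotvNl u w : dotv (- u) w = - dotv u w.
Proof. by rewrite /dotv mulNmx mxE. Qed.

Lemma dotvBl u v w : dotv (u - v) w = dotv u w - dotv v w.
Proof. by rewrite dotvDl dotvNl. Qed.

Lemma dotvZl a u w : dotv (a *: u) w = a * dotv u w.
Proof. by rewrite /dotv -scalemxAl mxE. Qed.

Lemma dotvDr u v w : dotv w (u + v) = dotv w u + dotv w v.
Proof. by rewrite dotvC dotvDl !(dotvC _ w). Qed.

Lemma dotvBr u v w : dotv w (u - v) = dotv w u - dotv w v.
Proof. by rewrite dotvC dotvBl !(dotvC _ w). Qed.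

Lemma dotvZr a u w : dotv w (a *: u) = a * dotv w u.
Proof. by rewrite dotvC dotvZl dotvC. Qed.

Lemma dotv0l u : dotv 0 u = 0.
Proof. by rewrite -(scale0r u) dotvZl mul0r. Qed.

Lemma dotv_suml (I : Type) (r : seq I) (Q : pred I) (G : I -> 'rV[R]_d) w :
  dotv (\sum_(i <- r | Q i) G i) w = \sum_(i <- r | Q i) dotv (G i) w.
Proof. by rewrite /dotv mulmx_suml summxE. Qed.

Lemma dotv_sumr (I : Type) (r : seq I) (Q : pred I) (G : I -> 'rV[R]_d) w :
  dotv w (\sum_(i <- r | Q i) G i) = \sum_(i <- r | Q i) dotv w (G i).
Proof. by rewrite dotvC dotv_suml; apply: eq_bigr => i _; rewrite dotvC. Qed.

Lemma dotv_mulmx u v (A : 'M[R]_d) : dotv (u *m A) v = dotv u (v *m A^T).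
Proof. by rewrite /dotv trmx_mul trmxK mulmxA. Qed.

Lemma dotvv_ge0 u : 0 <= dotv u u.
Proof. by rewrite dotvE; apply: sumr_ge0 => j _; rewrite -expr2 sqr_ge0. Qed.

Lemma enorm_dotv u : enorm u = Num.sqrt (dotv u u).
Proof.
by rewrite dotvE /enorm; congr Num.sqrt; apply: eq_bigr => j _; rewrite expr2.
Qed.

Lemma enorm_ge0 u : 0 <= enorm u.
Proof. exact: sqrtr_ge0. Qed.

Lemma sqr_enorm u : enorm u ^+ 2 = dotv u u.
Proof. by rewrite enorm_dotv sqr_sqrtr // dotvv_ge0. Qed.

Lemma enorm_eq0 u : enorm u = 0 -> u = 0.
Proof.
move=> /(congr1 (fun a => a ^+ 2)); rewrite sqr_enorm expr0n /= dotvE => /eqP.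
rewrite psumr_eq0 => [/allP h|j _]; last by rewrite -expr2 sqr_ge0.
apply/rowP => j; rewrite mxE; apply/eqP.
by have := h j (mem_index_enum j); rewrite -expr2 sqrf_eq0.
Qed.

Lemma enorm0 : enorm (0 : 'rV[R]_d) = 0.
Proof. by rewrite enorm_dotv dotv0l sqrtr0. Qed.

Lemma enormZ a u : enorm (a *: u) = `|a| * enorm u.
Proof.
by rewrite !enorm_dotv dotvZl dotvZr mulrA -expr2 sqrtrM ?sqr_ge0 // sqrtr_sqr.
Qed.

Lemma enormN u : enorm (- u) = enorm u.
Proof. by rewrite -scaleN1r enormZ normrN normr1 mul1r. Qed.

Lemma enormBC u v : enorm (u - v) = enorm (v - u).
Proof. by rewrite -enormN opprB. Qed.

Lemma dotv_le u v : dotv u v <= enorm u * enorm v.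
Proof.
have [u0|u0] := eqVneq (enorm u) 0.
  by rewrite (enorm_eq0 u0) dotv0l enorm0 mul0r.
have ugt0 : 0 < enorm u by rewrite lt_def u0 enorm_ge0.
have := dotvv_ge0 (enorm u *: v - (enorm v) *: u).
rewrite dotvBl !dotvBr !dotvZl !dotvZr -!sqr_enorm (dotvC v u).
have := enorm_ge0 v; rewrite le_eqVlt => /predU1P[v0 _|vgt0 h].
  by rewrite (enorm_eq0 (esym v0)) dotvC dotv0l enorm0 mulr0.
have : 0 <= 2 * (enorm u * enorm v) * (enorm u * enorm v - dotv u v) by nra.
by rewrite pmulr_rge0 ?subr_ge0 // !mulr_gt0.
Qed.

Lemma normr_dotv u v : `|dotv u v| <= enorm u * enorm v.
Proof.
by rewrite ler_norml dotv_le andbT lerNl -dotvNl -(enormN u) dotv_le.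
Qed.

Lemma enormD u v : enorm (u + v) <= enorm u + enorm v.
Proof.
rewrite -(@ler_pXn2r _ 2) ?nnegrE ?addr_ge0 ?enorm_ge0 //.
rewrite sqr_enorm dotvDl !dotvDr -!sqr_enorm (dotvC v u).
by have := dotv_le u v; nra.
Qed.

Lemma enormB u v : enorm (u - v) <= enorm u + enorm v.
Proof. by rewrite -(enormN v) enormD. Qed.

Lemma enorm_sum (I : Type) (r : seq I) (Q : pred I) (G : I -> 'rV[R]_d) :
  enorm (\sum_(i <- r | Q i) G i) <= \sum_(i <- r | Q i) enorm (G i).
Proof.
elim/big_ind2: _ => [|u a v b ha hb|//]; first by rewrite enorm0.
by apply: le_trans (enormD _ _) _; exact: lerD.
Qed.

Lemma sqr_enormB u v :
  enorm (u - v) ^+ 2 = enorm u ^+ 2 - 2 * dotv u v + enorm v ^+ 2.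
Proof.
by rewrite !sqr_enorm dotvBl !dotvBr (dotvC v u); lra.
Qed.

(** [opnorm] is a supremum, which dominates its set only once that set is known to be bounded above;
    this provides the bound. *)
Lemma enorm_mulmx_bounded (A : 'M[R]_d) :
  exists2 M, 0 <= M & forall v, enorm (v *m A) <= M * enorm v.
Proof.
exists (\sum_(j < d) enorm (row j A)); first by apply: sumr_ge0 => *; exact: enorm_ge0.
move=> v; rewrite mulmx_sum_row mulr_suml.
apply: le_trans (enorm_sum _ _ _) _; apply: ler_sum => j _.
rewrite enormZ mulrC ler_wpM2l ?enorm_ge0 //.
rewrite -(@ler_pXn2r _ 2) ?nnegrE ?normr_ge0 ?enorm_ge0 //.
rewrite real_normK ?num_real // sqr_enorm dotvE (bigD1 j) //= -expr2 lerDl.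
by apply: sumr_ge0 => i _; rewrite -expr2 sqr_ge0.
Qed.

Lemma enorm_mulmx_le (A : 'M[R]_d) v : enorm (v *m A) <= opnorm A * enorm v.
Proof.
have [M M0 hM] := enorm_mulmx_bounded A.
have [v0|v0] := eqVneq (enorm v) 0.
  by rewrite (enorm_eq0 v0) mul0mx enorm0 mulr0.
have vgt0 : 0 < enorm v by rewrite lt_def v0 enorm_ge0.
have vinv : `|(enorm v)^-1| = (enorm v)^-1 by rewrite ger0_norm ?invr_ge0 ?enorm_ge0.
rewrite -ler_pdivrMr // mulrC -vinv -enormZ scalemxAl; apply: ub_le_sup.
  exists M => _ [w /= w1 <-]; apply: le_trans (hM w) _.
  by rewrite -[leRHS]mulr1 ler_wpM2l.
exists ((enorm v)^-1 *: v) => //=.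
by rewrite enormZ vinv mulVf.
Qed.

(** Pairing [v *m A^T] with itself and moving one factor across the inner product. The bound [M] is
    arbitrary because the Jacobian is controlled by the Lipschitz constant, not by [opnorm]. *)
Lemma enorm_mulmx_tr (A : 'M[R]_d) M v : 0 <= M ->
  (forall w, enorm (w *m A) <= M * enorm w) -> enorm (v *m A^T) <= M * enorm v.
Proof.
move=> M0 hM; have [->|h0] := eqVneq (enorm (v *m A^T)) 0.
  by rewrite mulr_ge0 ?enorm_ge0.
have hgt0 : 0 < enorm (v *m A^T) by rewrite lt_def h0 enorm_ge0.
rewrite -(ler_pM2l hgt0) -expr2 sqr_enorm -dotv_mulmx.
apply: le_trans (dotv_le _ _) _.
by rewrite mulrA ler_wpM2r ?enorm_ge0 // mulrC hM.
Qed.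

End EuclideanSpace.

(** * Gradients and Taylor remainder *)

Section Calculus.
Context (R : realType) (d : nat).
Implicit Types (f F : 'rV[R]_d -> R) (u v w x y z : 'rV[R]_d).

Lemma derive_grad f x v : differentiable f x -> 'D_v f x = dotv (grad f x) v.
Proof.
move=> df; rewrite deriveE // [in LHS](row_sum_delta v) linear_sum dotvE /=.
by apply: eq_bigr => j _; rewrite linearZ /= mxE deriveE // mulrC.
Qed.

Lemma derive_cvg_right f x v : differentiable f x ->
  (fun h : R => h^-1 *: (f (h *: v + x) - f x)) @ 0^'+ --> dotv (grad f x) v.
Proof.
move=> df; rewrite -derive_grad // => A hA.
have /nbhs_ballP [_ /posnumP[e] xe_A] : ((fun h : R => h^-1 *: (f (h *: v + x) - f x)) @ 0^') A.
  by apply: (@diff_derivable _ _ _ f x v df).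
by exists e%:num => //= y xe_y /gt_eqF/negbT/xe_A; exact.
Qed.

(** Strong convexity on the segment from x to z, divided by the parameter h, in the limit h -> 0+.
    The term in h is put on the side of the difference quotient, so that the other side is
    constant. *)
Lemma strongly_convex_grad mu F x z : differentiable F x ->
  strongly_convex mu F ->
  F x + dotv (grad F x) (z - x) + mu / 2 * enorm (z - x) ^+ 2 <= F z.
Proof.
move=> dF sc; set v := z - x.
have lhs : (fun h : R => h^-1 *: (F (h *: v + x) - F x) - h * (mu / 2 * enorm v ^+ 2))
    @ 0^'+ --> dotv (grad F x) v - 0 * (mu / 2 * enorm v ^+ 2).
  apply: cvgB; first exact: derive_cvg_right.
  apply: cvgM; last exact: cvg_cst.
  exact: cvg_within.
have : dotv (grad F x) v - 0 * (mu / 2 * enorm v ^+ 2)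
       <= F z - F x - mu / 2 * enorm v ^+ 2.
  apply: cvgr_to_le lhs _; near=> h.
  have h0 : 0 < h by near: h; exact: nbhs_right_gt.
  have h1 : h < 1 by near: h; exact: nbhs_right_lt.
  have h01 : 0 <= h <= 1 by rewrite !ltW.
  have := sc h z x h01; rewrite -/v.
  have -> : h *: z + (1 - h) *: x = h *: v + x.
    by rewrite /v scalerBr scalerBl scale1r addrAC -addrA; congr (_ + _); rewrite addrC.
  move=> hs; rewrite lerBlDr -[_ *: _]/(_ * _) ler_pdivrMl //.
  by apply: le_trans (_ : _ <= h * F z + (1 - h) * F x
      - mu / 2 * h * (1 - h) * enorm v ^+ 2 - F x) _; [rewrite lerD2r|lra].
by rewrite mul0r subr0; lra.
Unshelve. all: by end_near. Qed.

(** The derivative along [- grad F x] is nonnegative at a minimizer, and it equals minus the squared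
    norm of the gradient. *)
Lemma minimizer_grad0 F x : differentiable F x -> minimizer F x -> grad F x = 0.
Proof.
move=> dF mF; apply: enorm_eq0.
have : 0 <= dotv (grad F x) (- grad F x).
  have lim := @derive_cvg_right F x (- grad F x) dF.
  apply: cvgr_to_ge lim _; near=> h.
  have h0 : 0 < h by near: h; exact: nbhs_right_gt.
  apply: mulr_ge0; [by rewrite invr_ge0 ltW|by rewrite subr_ge0; apply: mF].
rewrite dotvC dotvNl -sqr_enorm oppr_ge0 => h.
by apply/eqP; rewrite -sqrf_eq0 eq_le h sqr_ge0.
Unshelve. all: by end_near. Qed.

Lemma dotv_continuous w : continuous (fun u : 'rV[R]_d => dotv u w).
Proof.
move=> u; have -> : (fun u : 'rV[R]_d => dotv u w) =
    (fun u : 'rV[R]_d => \sum_(j < d) u ord0 j * w ord0 j).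
  by apply/funext => v; rewrite dotvE.
elim: (index_enum _) => [|j r IH].
  by rewrite (_ : (fun _ => _) = fun=> 0); [exact: cst_continuous|apply/funext => v; rewrite big_nil].
rewrite (_ : (fun _ => _) = fun v : 'rV[R]_d => v ord0 j * w ord0 j + \sum_(i <- r) v ord0 i * w ord0 i);
  last by apply/funext => v; rewrite big_cons.
apply: cvgD IH.
by apply: cvgM; [exact: coord_continuous|exact: cvg_cst].
Qed.

(* The mean value theorem is applied to t |-> <G (y + t v) - t v J, w>, with w
   the remainder itself. *)
Lemma taylor_remainder_le (G : 'rV[R]_d -> 'rV[R]_d) y v (B : R) :
  differentiable_everywhere G ->
  (forall t : R, 0 <= t <= 1 ->
     opnorm ('J G (y + t *: v) - 'J G y) <= B) ->
  enorm (G (y + v) - G y - v *m 'J G y) <= B * enorm v.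
Proof.
move=> dG hB; set w := (X in enorm X).
have [w0|w0] := eqVneq (enorm w) 0.
  rewrite w0; apply: le_trans (enorm_ge0 _) (le_trans (enorm_mulmx_le _ v) _).
  by apply: ler_wpM2r; [exact: enorm_ge0|apply: (hB 0); rewrite lexx ler01].
have wgt0 : 0 < enorm w by rewrite lt_def w0 enorm_ge0.
pose phi (t : R) := dotv (G (t *: v + y) - t *: (v *m 'J G y)) w.
have dphi (t : R) : is_derive t 1 phi (dotv (v *m ('J G (y + t *: v) - 'J G y)) w).
  have h : (fun h : R => h^-1 *: (phi (h *: 1 + t) - phi t)) @ 0^' -->
      dotv (v *m ('J G (y + t *: v) - 'J G y)) w.
    have -> : (fun h : R => h^-1 *: (phi (h *: 1 + t) - phi t)) = (fun h : R =>
        dotv (h^-1 *: (G (h *: v + (y + t *: v)) - G (y + t *: v))) w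
        - h^-1 * (h * dotv (v *m 'J G y) w)).
      apply/funext => h; rewrite /phi -[_ *: _]/(_ * _) dotvZl -mulrBr; congr (_ * _).
      rewrite [h *: 1]mulr1 scalerDl -addrA (addrC (t *: v)).
      by rewrite !dotvBl !dotvZl; lra.
    rewrite mulmxBr dotvBl; apply: cvgB.
      apply: (@cvg_comp _ _ _ _ (fun u => dotv u w)); last exact: dotv_continuous.
      rewrite -deriveEjacobian //; exact: (@diff_derivable _ _ _ G _ v (dG _)).
    apply: cvg_near_cst; near=> h.
    by rewrite mulrA mulVf ?mul1r //; near: h; exact: nbhs_dnbhs_neq.
  by split; [apply/cvg_ex; eexists; exact: h|exact/cvg_lim].
have cphi : {within `[0, 1], continuous phi}.
  apply: continuous_subspaceT => t; apply: differentiable_continuous.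
  by apply/derivable1_diffP; case: (dphi t).
have [t t01 ht] := MVT ltr01 (fun t _ => dphi t) cphi.
have t01' : 0 <= t <= 1 by move: t01; rewrite in_itv /= => /andP[/ltW -> /ltW ->].
have : enorm w ^+ 2 <= B * enorm v * enorm w.
  have -> : enorm w ^+ 2 = phi 1 - phi 0.
    by rewrite /phi !scale1r !scale0r add0r subr0 -dotvBl sqr_enorm (addrC v) addrAC.
  rewrite ht subr0 mulr1; apply: le_trans (dotv_le _ _) _.
  rewrite ler_wpM2r ?enorm_ge0 //; apply: le_trans (enorm_mulmx_le _ _) _.
  by rewrite ler_wpM2r ?enorm_ge0 // hB.
by rewrite expr2 ler_pM2r.
Unshelve. all: by end_near. Qed.

(** Difference quotients along v have norm at most L |v|; pairing them with their limit w gives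
    |w|^2 <= L |v| |w|. *)
Lemma jacobian_lipschitz (G : 'rV[R]_d -> 'rV[R]_d) y v (L : R) :
  differentiable_everywhere G ->
  (forall u z, enorm (G u - G z) <= L * enorm (u - z)) ->
  enorm (v *m 'J G y) <= L * enorm v.
Proof.
move=> dG GL; set w := v *m _.
have [w0|w0] := eqVneq (enorm w) 0.
  rewrite w0; have := GL (v + y) y; rewrite addrK; apply: le_trans.
  exact: enorm_ge0.
have wgt0 : 0 < enorm w by rewrite lt_def w0 enorm_ge0.
rewrite -(ler_pM2r wgt0) -expr2 sqr_enorm.
have : (fun h : R => dotv (h^-1 *: (G (h *: v + y) - G y)) w) @ 0^' --> dotv w w.
  apply: (@cvg_comp _ _ _ _ (fun u => dotv u w)); last exact: dotv_continuous.
  rewrite /w -deriveEjacobian //; exact: (@diff_derivable _ _ _ G _ v (dG _)).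
move/cvgr_to_le; apply; near=> h.
have h0 : h != 0 by near: h; exact: nbhs_dnbhs_neq.
apply: le_trans (dotv_le _ _) _; rewrite ler_wpM2r ?enorm_ge0 // enormZ normfV.
rewrite ler_pdivrMl ?normr_gt0 // mulrCA -enormZ.
by have := GL (h *: v + y) y; rewrite addrK.
Unshelve. all: by end_near. Qed.

End Calculus.

(** * Sampling without replacement *)

Section PermutationMean.
Context (R : realType) (n : nat).
Implicit Types (g h : 'S_n -> R) (s t : 'S_n).

Definition pmean g : R := (n`!)%:R^-1 * \sum_(s : 'S_n) g s.

Lemma fact_inv_ge0 : 0 <= (n`!)%:R^-1 :> R.
Proof. by rewrite invr_ge0. Qed.

Lemma pmean_le g h : (forall s, g s <= h s) -> pmean g <= pmean h.
Proof. by move=> gh; apply: ler_wpM2l; [exact: fact_inv_ge0|exact: ler_sum]. Qed.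

Lemma pmean_cst a : pmean (fun=> a) = a.
Proof.
by rewrite /pmean sumr_const card_Sn -[a *+ _]mulr_natl mulKf // pnatr_eq0 -lt0n fact_gt0.
Qed.

Lemma pmean_ge0 g : (forall s, 0 <= g s) -> 0 <= pmean g.
Proof. by move=> g0; rewrite -(pmean_cst 0) pmean_le. Qed.

Lemma eq_pmean g h : g =1 h -> pmean g = pmean h.
Proof. by move=> gh; congr (_ * _); apply: eq_bigr. Qed.

Lemma pmeanD g h : pmean (fun s => g s + h s) = pmean g + pmean h.
Proof. by rewrite /pmean big_split mulrDr. Qed.

Lemma pmeanZ a g : pmean (fun s => a * g s) = a * pmean g.
Proof. by rewrite /pmean -mulr_sumr mulrCA. Qed.

Lemma pmeanN g : pmean (fun s => - g s) = - pmean g.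
Proof. by rewrite /pmean sumrN mulrN. Qed.

Lemma pmeanB g h : pmean (fun s => g s - h s) = pmean g - pmean h.
Proof. by rewrite pmeanD pmeanN. Qed.

Lemma pmean_sum (I : Type) (r : seq I) (Q : pred I) (G : I -> 'S_n -> R) :
  pmean (fun s => \sum_(i <- r | Q i) G i s) = \sum_(i <- r | Q i) pmean (G i).
Proof. by rewrite /pmean exchange_big mulr_sumr. Qed.

Lemma pmean_norm g : `|pmean g| <= pmean (fun s => `|g s|).
Proof.
rewrite /pmean normrM ger0_norm ?fact_inv_ge0 //.
by apply: ler_wpM2l; [exact: fact_inv_ge0|exact: ler_norm_sum].
Qed.

(** Exchangeability: [(t * s)%g] applies [t] first, so it permutes the positions and not the
    components. *)
Lemma pmean_reindex t g : pmean g = pmean (fun s => g (t * s)%g).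
Proof.
by congr (_ * _); rewrite (reindex_inj (mulgI t)).
Qed.

Lemma sqr_pmean_le g : pmean g ^+ 2 <= pmean (fun s => g s ^+ 2).
Proof.
have : 0 <= pmean (fun s => (g s - pmean g) ^+ 2) by apply: pmean_ge0 => s; exact: sqr_ge0.
have -> : pmean (fun s => (g s - pmean g) ^+ 2)
    = pmean (fun s => g s ^+ 2) - pmean g ^+ 2; last by rewrite subr_ge0.
rewrite (eq_pmean (h := fun s => g s ^+ 2 + ((- 2 * pmean g) * g s + pmean g ^+ 2)));
  last by move=> s /=; ring.
by rewrite pmeanD pmeanD pmeanZ pmean_cst; ring.
Qed.

Lemma pmean_le_sqrt g a : 0 <= a -> pmean (fun s => g s ^+ 2) <= a ^+ 2 ->
  pmean g <= a.
Proof.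
move=> a0 ga; have [g0|/ltW g0] := leP 0 (pmean g); last exact: le_trans a0.
by rewrite -(@ler_pXn2r _ 2) ?nnegrE // (le_trans (sqr_pmean_le g)).
Qed.

End PermutationMean.

Lemma sqr_sum_le (R : realType) (n : nat) (z : 'I_n -> R) :
  (\sum_i z i) ^+ 2 <= n%:R * \sum_i z i ^+ 2.
Proof.
have := normr_dotv (const_mx 1) (\row_j z j).
have -> : dotv (const_mx 1) (\row_j z j) = \sum_i z i.
  by rewrite dotvE; apply: eq_bigr => i _; rewrite !mxE mul1r.
move=> h; have : `|\sum_i z i| ^+ 2 <= (enorm (const_mx 1 : 'rV[R]_n) * enorm (\row_j z j)) ^+ 2.
  by rewrite lerXn2r ?nnegrE ?mulr_ge0 ?enorm_ge0.
rewrite real_normK ?num_real // exprMn !sqr_enorm !dotvE.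
have -> : \sum_(j < n) (const_mx 1 : 'rV[R]_n) ord0 j * (const_mx 1 : 'rV[R]_n) ord0 j = n%:R.
  by rewrite (eq_bigr (fun=> 1)) ?sumr_const ?card_ord // => i _; rewrite !mxE mulr1.
by congr (_ <= _ * _); apply: eq_bigr => i _; rewrite !mxE expr2.
Qed.

Section SamplingWithoutReplacement.
Context (R : realType) (d n : nat) (g : 'I_n -> 'rV[R]_d) (G : R).
Hypotheses (g_sum : \sum_i g i = 0) (g_le : forall i, enorm (g i) <= G).

Lemma sum_perm (s : 'S_n) : \sum_i g (s i) = 0.
Proof. by rewrite -[RHS]g_sum [RHS](reindex_inj (@perm_inj _ s)). Qed.

(* Exchangeability makes all the covariances of distinct positions equal, and
   they sum with the variance to zero. *)
Lemma cov_le0 (i j : 'I_n) : i != j ->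
  pmean (fun s : 'S_n => dotv (g (s i)) (g (s j))) <= 0.
Proof.
move=> ij; set c := fun l => pmean (fun s : 'S_n => dotv (g (s i)) (g (s l))).
have c_eq l : l != i -> c l = c j.
  move=> li; rewrite /c (pmean_reindex (tperm l j)); apply: eq_pmean => s.
  by rewrite !permM tpermL tpermD // eq_sym.
have : \sum_l c l = 0.
  rewrite -pmean_sum (eq_pmean (h := fun=> 0)) ?pmean_cst // => s.
  by rewrite -dotv_sumr sum_perm dotvC dotv0l.
rewrite (bigD1 i) //= => c0; rewrite -/(c j) leNgt; apply/negP => cj.
suff : 0 < c i + \sum_(l < n | l != i) c l by rewrite c0 ltxx.
apply: ltr_wpDl; first by apply: pmean_ge0 => s; exact: dotvv_ge0.
rewrite (bigD1 j) 1?eq_sym //=; apply: ltr_pwDl => //; apply: sumr_ge0 => l /andP[li _].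
by rewrite c_eq // ltW.
Qed.

(** In the expanded square the off-diagonal terms are nonpositive, by [cov_le0] and the signs of the
    weights; only the diagonal is left. *)
Lemma weighted_sample_var (w : 'I_n -> R) : (forall i, 0 <= w i) ->
  pmean (fun s : 'S_n => enorm (\sum_i w i *: g (s i)) ^+ 2)
    <= G ^+ 2 * \sum_i w i ^+ 2.
Proof.
move=> w0.
rewrite (eq_pmean (h := fun s : 'S_n =>
    \sum_i \sum_j w i * w j * dotv (g (s i)) (g (s j)))); last first.
  move=> s; rewrite sqr_enorm dotv_suml; apply: eq_bigr => i _.
  by rewrite dotvZl dotv_sumr mulr_sumr; apply: eq_bigr => j _; rewrite dotvZr mulrA.
rewrite pmean_sum mulr_sumr; apply: ler_sum => i _.
rewrite pmean_sum (bigD1 i) //= pmeanZ -[leRHS]addr0; apply: lerD.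
  rewrite -expr2 mulrC ler_wpM2r ?sqr_ge0 // -(pmean_cst n (G ^+ 2)).
  apply: pmean_le => s; rewrite -sqr_enorm lerXn2r ?nnegrE ?enorm_ge0 //.
  exact: le_trans (enorm_ge0 _) (g_le (s i)).
apply: sumr_le0 => j ji; rewrite pmeanZ; apply: mulr_ge0_le0; first exact: mulr_ge0.
by apply: cov_le0; rewrite eq_sym.
Qed.

Lemma window_sample_var (eta : nat -> R) (e : R) (m k : nat) :
  (forall j, (m <= j < k)%N -> 0 <= eta j <= e) ->
  pmean (fun s : 'S_n => enorm (\sum_(j < n | (m <= j < k)%N) eta j *: g (s j)) ^+ 2)
    <= G ^+ 2 * (n%:R * e ^+ 2).
Proof.
move=> eta_le; pose w (j : 'I_n) := if (m <= j < k)%N then eta j else 0.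
rewrite (eq_pmean (h := fun s : 'S_n => enorm (\sum_j w j *: g (s j)) ^+ 2)).
  apply: le_trans (weighted_sample_var _) _ => [j|].
    by rewrite /w; case: ifP => // /eta_le/andP[].
  rewrite ler_wpM2l ?sqr_ge0 //.
  have -> : n%:R * e ^+ 2 = \sum_(j < n) e ^+ 2 by rewrite sumr_const card_ord mulr_natl.
  apply: ler_sum => j _; rewrite /w; case: ifP => [/eta_le/andP[h0 h1]|_].
    by rewrite lerXn2r ?nnegrE // (le_trans h0).
  by rewrite expr0n sqr_ge0.
move=> s; rewrite big_mkcond; congr (enorm _ ^+ 2).
by apply: eq_bigr => j _; rewrite /w; case: ifP; rewrite ?scale0r.
Qed.

End SamplingWithoutReplacement.

(** * One epoch *)

(** The partial sums A_i of [a] satisfy A_{i+1} <= (1 + b) A_i + al_i. The sums are bounded, rather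
    than the single terms, because they are what enters the drift. *)
Lemma sum_gronwall (R : realType) (a al : nat -> R) (b : R) (n : nat) :
  0 <= b -> (forall i, 0 <= al i) ->
  (forall i, (i < n)%N -> a i <= al i + b * \sum_(j < i) a j) ->
  forall i, (i <= n)%N -> \sum_(j < i) a j <= (1 + b) ^+ i * \sum_(j < i) al j.
Proof.
move=> b0 al0 h; elim=> [|i IH] lin; first by rewrite !big_ord0 mulr0.
rewrite !big_ord_recr /= mulrDr; set A := \sum_(j < i) a j in IH *.
have step : A + a i <= (1 + b) * A + al i by have := h i lin; rewrite -/A; lra.
apply: le_trans step _; apply: lerD.
  by rewrite exprS -mulrA; apply: ler_wpM2l; [lra|apply: IH; exact: ltnW].
by rewrite -[leLHS]mul1r; apply: ler_wpM2r => //; apply: exprn_ege1; lra.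
Qed.

Section WindowSums.
Context (V : zmodType) (n : nat) (F : 'I_n -> V).

Lemma window_sum0 (m i : nat) : (i <= m)%N -> \sum_(j < n | (m <= j < i)%N) F j = 0.
Proof.
move=> im; apply: big_pred0 => j; apply/negbTE; rewrite negb_and -ltnNge -leqNgt.
by case: ltnP => //= mj; apply: leq_trans mj.
Qed.

Lemma window_sum_recr (m : nat) (i : 'I_n) : (m <= i)%N ->
  \sum_(j < n | (m <= j < i.+1)%N) F j = \sum_(j < n | (m <= j < i)%N) F j + F i.
Proof.
move=> mi; rewrite (bigD1 i) ?mi ?ltnSn //= addrC; congr (_ + _).
apply: eq_bigl => j; rewrite ltnS -andbA; congr (_ && _).
by rewrite ltn_neqAle andbC.
Qed.

End WindowSums.

(** Multiplies n e (n e |u|^2) among the errors of [fine_epoch]. Here [c1] bounds n e and [E0]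
    bounds (1 + e L)^n. The first summand comes from the bias of the mean step, the second from its
    square. *)
Definition fine_rate_const (R : realType) (L c1 E0 : R) : R :=
  2 * (L ^+ 2 * (1 + c1 * L * E0) + 4 * L ^+ 2 * E0)
  + 2 * L ^+ 2 * (1 + c1 * L * E0) ^+ 2.

(** Multiplies n e^3 + n^3 e^4 in [fine_epoch]. [B ^+ 2] n e^2 bounds the second moment of the
    random drift, [Cs] e the effect of a swap, and rho [Cr] n e^(3/2) the random part of the mean
    Taylor remainder. *)
Definition fine_noise_const (R : realType) (L G c1 E0 mu rho : R) : R :=
  let B := Num.sqrt (2 * G ^+ 2 * (1 + (c1 * L) ^+ 2 * E0 ^+ 2)) in
  let Cs := 2 * L * G * E0 in
  let Cr := 2 * B + 4 * B ^+ 2 + 4 * B ^+ 2 * (1 + c1) in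
  4 / mu * (L ^+ 2 * B * (1 + c1) + c1 * L * Cs + rho * Cr + Cs) ^+ 2
  + 2 * L ^+ 2 * B ^+ 2.

Section Epoch.
Context (R : realType) (d n : nat) (gr : 'I_n -> 'rV[R]_d -> 'rV[R]_d).
Context (L G : R) (T : 'rV[R]_d) (eta : nat -> R).
Context (x : 'S_n -> nat -> 'rV[R]_d) (y : 'rV[R]_d).
Hypotheses (L0 : 0 <= L)
  (gr_lip : forall i u v, enorm (gr i u - gr i v) <= L * enorm (u - v))
  (grT : \sum_i gr i T = 0) (grT_le : forall i, enorm (gr i T) <= G)
  (gr_le : forall s i j, (i <= n)%N -> enorm (gr j (x s i)) <= G)
  (eta0 : forall i, 0 <= eta i)
  (x0 : forall s, x s 0%N = y)
  (x_step : forall s (i : 'I_n), x s i.+1 = x s i - eta i *: gr (s i) (x s i)).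

Lemma step_lip (i : 'I_n) u v a :  0 <= a ->
  enorm ((u - a *: gr i u) - (v - a *: gr i v)) <= (1 + a * L) * enorm (u - v).
Proof.
move=> a0; rewrite opprD addrACA -opprD -scalerBr.
apply: le_trans (enormB _ _) _; rewrite mulrDl mul1r lerD2l enormZ ger0_norm //.
by rewrite -mulrA ler_wpM2l.
Qed.

Lemma x_local (s s' : 'S_n) i : (i <= n)%N ->
  (forall j : 'I_n, (j < i)%N -> s j = s' j) -> x s i = x s' i.
Proof.
elim: i => [|i IH] lin hs; first by rewrite !x0.
rewrite !(x_step _ (Ordinal lin)) /= hs //= IH //; first exact: ltnW.
by move=> j ji; apply: hs; apply: ltnW.
Qed.

Lemma x_tperm_local (i j : 'I_n) s : (i <= j)%N -> x (tperm i j * s)%g i = x s i.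
Proof.
move=> ij; apply: x_local => [|l li]; first exact: ltnW.
rewrite permM tpermD // -val_eqE neq_ltn ?li ?orbT //.
by rewrite (leq_trans li ij) orbT.
Qed.

(** The displacement that the steps from [m] on would produce with all gradients frozen at [T]. It
    is the random part of the drift, of order e sqrt n. *)
Definition noise (m : nat) (s : 'S_n) (i : nat) : 'rV[R]_d :=
  \sum_(j < n | (m <= j < i)%N) eta j *: gr (s j) T.

(** * Drift of the iterates between position [m] and the end of the epoch *)

Section Drift.
Context (m : nat) (e E0 : R).
Hypotheses (mn : (m <= n)%N) (eta_le : forall j, (m <= j < n)%N -> eta j <= e).
Hypotheses (e0 : 0 <= e) (E0_ge : (1 + e * L) ^+ n <= E0).

Lemma x_window s i : (m <= i <= n)%N ->
  x s i = x s m - \sum_(j < n | (m <= j < i)%N) eta j *: gr (s j) (x s j).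
Proof.
elim: i => [|i IH] /andP[mi lin].
  by move: mi; rewrite leqn0 => /eqP ->; rewrite window_sum0 // subr0.
case: ltngtP mi => // [mi _|<- _]; last by rewrite window_sum0 // subr0.
rewrite (x_step _ (Ordinal lin)) (window_sum_recr _ (i := Ordinal lin)) //= IH ?opprD ?addrA //.
by rewrite -ltnS mi ltnW.
Qed.

(** The noise together with its amplification by the Gronwall argument of [drift]. *)
Definition noise_drift (s : 'S_n) (i : nat) : R :=
  enorm (noise m s i) + e * L * E0 * \sum_(j < n) enorm (noise m s j).

Lemma E0_ge0 : 0 <= E0.
Proof. by apply: le_trans E0_ge; apply: exprn_ge0; rewrite addr_ge0 ?mulr_ge0. Qed.

Lemma noise_drift_ge0 s i : 0 <= noise_drift s i.
Proof.
rewrite addr_ge0 ?enorm_ge0 // mulr_ge0 ?mulr_ge0 ?E0_ge0 //.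
by apply: sumr_ge0 => *; exact: enorm_ge0.
Qed.

(** Each gradient is split into its value at [T], which makes up the noise, and a Lipschitz
    error. *)
Lemma drift_pre s i : (m <= i <= n)%N ->
  enorm (x s i - x s m) <= enorm (noise m s i)
    + e * L * \sum_(j < n | (m <= j < i)%N) enorm (x s j - T).
Proof.
move=> /andP[mi lin]; rewrite x_window ?mi // addrC addKr enormN.
rewrite (eq_bigr (fun j : 'I_n => eta j *: gr (s j) T
    + eta j *: (gr (s j) (x s j) - gr (s j) T))); last first.
  by move=> j _; rewrite -scalerDr addrC subrK.
rewrite big_split /= -/(noise m s i); apply: le_trans (enormD _ _) _.
rewrite lerD2l mulr_sumr; apply: le_trans (enorm_sum _ _ _) _.
apply: ler_sum => j /andP[mj ji]; rewrite enormZ ger0_norm // -mulrA.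
apply: ler_pM => //; first exact: enorm_ge0.
by apply: eta_le; rewrite mj ltn_ord.
Qed.

(** Gronwall applied to the distances to [T] separates a part proportional to the distance at
    position [m] from a random part that depends on the permutation through gradients at [T]
    only. *)
Lemma drift s i : (m <= i <= n)%N ->
  enorm (x s i - x s m)
    <= n%:R * e * L * E0 * enorm (x s m - T) + noise_drift s i.
Proof.
move=> /andP[mi lin].
(* Extended by zero before [m], so that sums over the window become the initial sums of
   [sum_gronwall]. *)
pose a j := if (m <= j)%N then enorm (x s j - T) else 0.
pose al j := if (m <= j)%N then enorm (x s m - T) + enorm (noise m s j) else 0.
have window_a k : (k <= n)%N ->
    \sum_(j < n | (m <= j < k)%N) enorm (x s j - T) = \sum_(j < k) a j.
  move=> kn; rewrite (big_ord_widen n a) // [RHS]big_mkcond [LHS]big_mkcond /=.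
  by apply: eq_bigr => j _; rewrite /a; case: (m <= j)%N; case: (j < k)%N.
have eL0 : 0 <= e * L by rewrite mulr_ge0.
have al0 j : 0 <= al j by rewrite /al; case: ifP => // _; rewrite addr_ge0 ?enorm_ge0.
have a_rec k : (k < n)%N -> a k <= al k + e * L * \sum_(j < k) a j.
  move=> kn; rewrite /a /al; case: ifP => [mk|_].
    have := drift_pre s (i := k); rewrite mk ltnW // => /(_ isT).
    rewrite window_a 1?ltnW // -/a => h.
    have := enormD (x s k - x s m) (x s m - T); rewrite addrA subrK; lra.
  by rewrite add0r mulr_ge0 //; apply: sumr_ge0 => j _; case: ifP; rewrite ?enorm_ge0.
have := sum_gronwall eL0 al0 a_rec lin => hS.
have al_sum0 k : 0 <= \sum_(j < k) al j by apply: sumr_ge0.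
have {}hS : \sum_(j < i) a j <= E0 * \sum_(j < i) al j.
  apply: le_trans hS _; apply: ler_wpM2r => //; apply: le_trans E0_ge.
  by apply: ler_weXn2l => //; lra.
have hal : \sum_(j < i) al j <= n%:R * enorm (x s m - T) + \sum_(j < n) enorm (noise m s j).
  have -> : n%:R * enorm (x s m - T) = \sum_(j < n) enorm (x s m - T).
    by rewrite sumr_const card_ord mulr_natl.
  rewrite -big_split /= (big_ord_widen n al) // [leLHS]big_mkcond /=.
  apply: ler_sum => j _; rewrite /al; case: ifP => _; first case: ifP => // _.
    by rewrite addr_ge0 ?enorm_ge0.
  by rewrite addr_ge0 ?enorm_ge0.
have := drift_pre s (i := i); rewrite mi lin => /(_ isT); rewrite window_a // => h.
apply: le_trans h _; rewrite /noise_drift [leRHS]addrCA lerD2l.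
have -> : n%:R * e * L * E0 * enorm (x s m - T) = e * L * E0 * (n%:R * enorm (x s m - T)).
  by ring.
rewrite -mulrDr -(mulrA _ E0); apply: ler_wpM2l => //; apply: le_trans hS _.
by apply: ler_wpM2l => //; exact: E0_ge0.
Qed.

Lemma noise_var i : pmean (fun s => enorm (noise m s i) ^+ 2) <= G ^+ 2 * (n%:R * e ^+ 2).
Proof.
case: (leqP i n) => [lin|ni].
  apply: (window_sample_var grT grT_le) => j /andP[mj ji].
  by rewrite eta0 eta_le // mj (leq_trans ji).
(* Beyond n the window is already cut off by the index type ['I_n]. *)
rewrite (eq_pmean (h := fun s => enorm (noise m s n) ^+ 2)) => [|s].
  apply: (window_sample_var grT grT_le (eta := eta) (m := m) (k := n)) => j jn.
  by rewrite eta0 eta_le.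
congr (enorm _ ^+ 2); apply: eq_bigl => j.
by rewrite (ltn_ord j) (ltn_trans (ltn_ord j) ni).
Qed.

(** The amplified term costs (n e L)^2 E0^2, by Cauchy-Schwarz on the sum of the n noise norms. As n
    e L is bounded, the order n e^2 of the plain noise is preserved. *)
Lemma noise_drift_var (c : R) i : n%:R * (e * L) <= c ->
  pmean (fun s => noise_drift s i ^+ 2)
    <= 2 * G ^+ 2 * (1 + c ^+ 2 * E0 ^+ 2) * (n%:R * e ^+ 2).
Proof.
move=> hc; set b := e * L * E0.
have eL0 : 0 <= e * L by rewrite mulr_ge0.
have E00 := E0_ge0.
apply: (@le_trans _ _ (pmean (fun s => 2 * enorm (noise m s i) ^+ 2
    + 2 * b ^+ 2 * n%:R * \sum_(j < n) enorm (noise m s j) ^+ 2))).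
  apply: pmean_le => s; rewrite /noise_drift -/b.
  have := sqr_sum_le (fun j : 'I_n => enorm (noise m s j)).
  set A := enorm _; set S := \sum_(j < n) _; set Q := \sum_(j < n) _ => SQ.
  have : 0 <= 2 * b ^+ 2 * (n%:R * Q - S ^+ 2).
    by rewrite mulr_ge0 ?subr_ge0 // mulr_ge0 ?sqr_ge0.
  by have := sqr_ge0 (A - b * S); nra.
rewrite pmeanD !pmeanZ pmean_sum.
set W := G ^+ 2 * (n%:R * e ^+ 2).
have W0 : 0 <= W by rewrite mulr_ge0 ?sqr_ge0 // mulr_ge0 ?sqr_ge0.
have SW : \sum_(j < n) pmean (fun s => enorm (noise m s j) ^+ 2) <= n%:R * W.
  have -> : n%:R * W = \sum_(j < n) W by rewrite sumr_const card_ord mulr_natl.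
  by apply: ler_sum => j _; exact: noise_var.
apply: (@le_trans _ _ (2 * W + 2 * b ^+ 2 * n%:R * (n%:R * W))).
  apply: lerD; first by rewrite ler_pM2l ?noise_var.
  by apply: ler_wpM2l => //; rewrite mulr_ge0 // mulr_ge0 ?sqr_ge0.
have -> : 2 * W + 2 * b ^+ 2 * n%:R * (n%:R * W)
    = 2 * W * (1 + (n%:R * (e * L)) ^+ 2 * E0 ^+ 2) by rewrite /b; ring.
have -> : 2 * G ^+ 2 * (1 + c ^+ 2 * E0 ^+ 2) * (n%:R * e ^+ 2)
    = 2 * W * (1 + c ^+ 2 * E0 ^+ 2) by rewrite /W; ring.
have nel : 0 <= n%:R * (e * L) by rewrite mulr_ge0.
apply: ler_wpM2l; first exact: mulr_ge0.
rewrite lerD2l; apply: ler_wpM2r; first exact: sqr_ge0.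
by rewrite lerXn2r ?nnegrE // (le_trans nel).
Qed.

(** Only the drift is used, not the monotonicity of the mean gradient: the distance grows by a
    constant factor, which is acceptable for boundedly many epochs. *)
Lemma coarse_epoch (c : R) : n%:R * (e * L) <= c ->
  pmean (fun s => enorm (x s n - T) ^+ 2)
    <= 2 * (1 + c * E0) ^+ 2 * pmean (fun s => enorm (x s m - T) ^+ 2)
     + 4 * G ^+ 2 * (1 + c ^+ 2 * E0 ^+ 2) * (n%:R * e ^+ 2).
Proof.
move=> hc; have E00 := E0_ge0; have nel : 0 <= n%:R * (e * L) by rewrite !mulr_ge0.
have c0 : 0 <= c by exact: le_trans hc.
apply: (@le_trans _ _ (pmean (fun s => 2 * (1 + c * E0) ^+ 2 * enorm (x s m - T) ^+ 2
    + 2 * noise_drift s n ^+ 2))).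
  apply: pmean_le => s.
  have := drift s (i := n); rewrite mn leqnn => /(_ isT) h.
  have b0 := noise_drift_ge0 s n.
  have h2 := enormD (x s n - x s m) (x s m - T); rewrite addrA subrK in h2.
  set u := enorm (x s m - T) in h h2 *; set b := noise_drift s n in h b0 *.
  have u0 : 0 <= u by exact: enorm_ge0.
  have h3 : enorm (x s n - T) <= (1 + c * E0) * u + b.
    have : n%:R * e * L * E0 * u <= c * E0 * u.
      by rewrite ler_wpM2r // ler_wpM2r // -mulrA.
    by lra.
  have : enorm (x s n - T) ^+ 2 <= ((1 + c * E0) * u + b) ^+ 2.
    by rewrite lerXn2r ?nnegrE ?enorm_ge0 // (le_trans (enorm_ge0 _) h3).
  by have := sqr_ge0 ((1 + c * E0) * u - b); nra.
rewrite pmeanD !pmeanZ lerD2l.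
by have := noise_drift_var n hc; lra.
Qed.

End Drift.



Hypothesis n0 : (0 < n)%N.

Definition gbar (z : 'rV[R]_d) : 'rV[R]_d := n%:R^-1 *: \sum_i gr i z.

Let nR0 : 0 < n%:R :> R.
Proof. by rewrite ltr0n. Qed.

Let G0 : 0 <= G.
Proof. by have := grT_le (Ordinal n0); apply: le_trans; exact: enorm_ge0. Qed.

Lemma gbarE z : n%:R *: gbar z = \sum_i gr i z.
Proof. by rewrite /gbar scalerA divff ?scale1r // gt_eqF. Qed.

Lemma gbar_lip u v : enorm (gbar u - gbar v) <= L * enorm (u - v).
Proof.
rewrite /gbar -scalerBr enormZ ger0_norm ?invr_ge0 // ler_pdivrMl // -sumrB.
apply: le_trans (enorm_sum _ _ _) _.
have -> : n%:R * (L * enorm (u - v)) = \sum_(i < n) L * enorm (u - v).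
  by rewrite sumr_const card_ord mulr_natl.
by apply: ler_sum => i _; exact: gr_lip.
Qed.

Lemma gbarT : gbar T = 0.
Proof. by rewrite /gbar grT scaler0. Qed.

Lemma gbar_le u : enorm (gbar u) <= L * enorm (u - T).
Proof. by have := gbar_lip u T; rewrite gbarT subr0. Qed.

Lemma sum_gr_perm (s : 'S_n) z : \sum_i gr (s i) z = n%:R *: gbar z.
Proof. by rewrite gbarE [RHS](reindex_inj (@perm_inj _ s)). Qed.

(* The iterate x s i depends on s only through the positions before i. *)
Lemma exchange_position (i l : 'I_n) (Phi : 'I_n -> 'rV[R]_d -> R) : (i <= l)%N ->
  pmean (fun s => Phi (s i) (x s i)) = pmean (fun s => Phi (s l) (x s i)).
Proof.
move=> il; rewrite (pmean_reindex (tperm i l)); apply: eq_pmean => s.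
by rewrite x_tperm_local // permM tpermL.
Qed.

(** The sum over the unseen positions is n <gbar, u> minus the used gradients, which cost i L |u|^2
    + |S| |u|. The first cost is at most n mu |u|^2 / 4, and Young's inequality spends as much on
    the second, so half of n mu survives. The noise |S|^2 / (n mu) has mean at most G^2 / mu.
    Division by n - i uses n - i <= n in front of |u|^2 and n - i >= n / 2 in front of the noise. *)
Lemma descent_inner (mu : R) (i : 'I_n) : 0 < mu ->
  (forall s, mu * enorm (x s i - T) ^+ 2 <= dotv (gbar (x s i)) (x s i - T)) ->
  i%:R * L <= n%:R * mu / 4 -> i%:R <= n%:R / 2 :> R ->
  mu / 2 * pmean (fun s => enorm (x s i - T) ^+ 2) - 2 * G ^+ 2 / (mu * n%:R)
    <= pmean (fun s => dotv (gr (s i) (x s i)) (x s i - T)).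
Proof.
move=> mu0 sc iL i2; set A := pmean (fun s => enorm _ ^+ 2); set D := pmean _.
pose S (s : 'S_n) := \sum_(l < n | (0 <= l < i)%N) 1 *: gr (s l) T.
have varS : pmean (fun s => enorm (S s) ^+ 2) <= G ^+ 2 * (n%:R * 1 ^+ 2).
  apply: (window_sample_var grT grT_le (eta := fun=> 1) (m := 0)) => j _.
  by rewrite ler01 lexx.
have card_lt : \sum_(l < n | (l < i)%N) 1 = i%:R :> R.
  by rewrite -(big_ord_widen n (fun=> 1)) ?sumr_const ?card_ord // ltnW.
have card_ge : \sum_(l < n | ~~ (l < i)%N) 1 = n%:R - i%:R :> R.
  have := sumr_const 'I_n (1 : R); rewrite card_ord => <-.
  by rewrite -card_lt [in RHS](bigID (fun l : 'I_n => (l < i)%N)) /= addrAC subrr add0r.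
have sumD : (n%:R - i%:R) * D
    = pmean (fun s => \sum_(l < n | ~~ (l < i)%N) dotv (gr (s l) (x s i)) (x s i - T)).
  (* All n - i unseen positions contribute the same mean. *)
  rewrite pmean_sum -card_ge mulr_suml; apply: eq_bigr => l; rewrite mul1r -leqNgt => il.
  exact: (exchange_position (fun j z => dotv (gr j z) (z - T))).
have lowD : n%:R * mu / 2 * A - G ^+ 2 / mu <= (n%:R - i%:R) * D.
  apply: (@le_trans _ _ (pmean (fun s => n%:R * mu / 2 * enorm (x s i - T) ^+ 2
      + - (n%:R * mu)^-1 * enorm (S s) ^+ 2))).
    rewrite pmeanD !pmeanZ lerD2l mulNr lerN2 ler_pdivrMl ?mulr_gt0 //.
    have -> : n%:R * mu * (G ^+ 2 / mu) = G ^+ 2 * (n%:R * 1 ^+ 2).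
      by field; rewrite gt_eqF.
    exact: varS.
  rewrite sumD; apply: pmean_le => s.
  set u := x s i - T.
  have tot : \sum_(l < n | ~~ (l < i)%N) dotv (gr (s l) (x s i)) u
      = n%:R * dotv (gbar (x s i)) u - \sum_(l < n | (l < i)%N) dotv (gr (s l) (x s i)) u.
    rewrite -dotvZl -(sum_gr_perm s) dotv_suml [in RHS](bigID (fun l : 'I_n => (l < i)%N)) /=.
    by rewrite addrAC subrr add0r.
  have past : \sum_(l < n | (l < i)%N) dotv (gr (s l) (x s i)) u
      <= i%:R * L * enorm u ^+ 2 + enorm (S s) * enorm u.
    apply: (@le_trans _ _ (\sum_(l < n | (l < i)%N) 1 * (L * enorm u ^+ 2) + dotv (S s) u)).
      have -> : dotv (S s) u = \sum_(l < n | (l < i)%N) dotv (gr (s l) T) u.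
        rewrite /S dotv_suml; apply: eq_big => [l|l _]; first by rewrite leq0n.
        by rewrite scale1r.
      rewrite -big_split; apply: ler_sum => l _ /=.
      rewrite -lerBlDr -dotvBl; apply: le_trans (dotv_le _ _) _.
      by rewrite mul1r expr2 mulrA ler_wpM2r ?enorm_ge0 ?gr_lip.
    by rewrite -mulr_suml card_lt mulrA lerD2l dotv_le.
  have := sc s; rewrite -/u tot => h.
  have h1 : n%:R * (mu * enorm u ^+ 2) <= n%:R * dotv (gbar (x s i)) u by rewrite ler_pM2l.
  have h2 : i%:R * L * enorm u ^+ 2 <= n%:R * mu / 4 * enorm u ^+ 2.
    by rewrite ler_wpM2r ?sqr_ge0.
  have k0 : 0 < n%:R * mu by rewrite mulr_gt0.
  have h3 : enorm (S s) * enorm u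
      <= n%:R * mu / 4 * enorm u ^+ 2 + (n%:R * mu)^-1 * enorm (S s) ^+ 2.
    have : 0 <= (n%:R * mu)^-1 * (enorm (S s) - n%:R * mu / 2 * enorm u) ^+ 2.
      by rewrite mulr_ge0 ?sqr_ge0 // invr_ge0 ltW.
    suff -> : (n%:R * mu)^-1 * (enorm (S s) - n%:R * mu / 2 * enorm u) ^+ 2
       = n%:R * mu / 4 * enorm u ^+ 2 + (n%:R * mu)^-1 * enorm (S s) ^+ 2
         - enorm (S s) * enorm u by rewrite subr_ge0.
    by field; rewrite !gt_eqF.
  by lra.
have A0 : 0 <= A by apply: pmean_ge0 => s; exact: sqr_ge0.
have k0 : 0 < n%:R - i%:R :> R by have := nR0; move: i2; lra.
rewrite -(ler_pM2l k0); apply: le_trans lowD; rewrite mulrBr; apply: lerB.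
  rewrite mulrA -(mulrA n%:R); apply: ler_wpM2r => //.
  by apply: ler_wpM2r; [exact: divr_ge0 (ltW mu0) _|rewrite gerBl].
have -> : (n%:R - i%:R) * (2 * G ^+ 2 / (mu * n%:R)) = G ^+ 2 / mu * ((n%:R - i%:R) * 2 / n%:R).
  by field; rewrite !gt_eqF.
apply: ler_peMr; first exact: divr_ge0 (sqr_ge0 _) (ltW mu0).
by rewrite ler_pdivlMr //; lra.
Qed.

Lemma warmup_step (mu : R) (i : 'I_n) : 0 < mu ->
  (forall s, mu * enorm (x s i - T) ^+ 2 <= dotv (gbar (x s i)) (x s i - T)) ->
  i%:R * L <= n%:R * mu / 4 -> i%:R <= n%:R / 2 :> R ->
  pmean (fun s => enorm (x s i.+1 - T) ^+ 2)
    <= (1 - eta i * mu) * pmean (fun s => enorm (x s i - T) ^+ 2)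
     + 4 * G ^+ 2 / mu * (eta i / n%:R) + G ^+ 2 * eta i ^+ 2.
Proof.
move=> mu0 sc iL i2; have := descent_inner mu0 sc iL i2.
set A := pmean _; set D := pmean _ => hD.
apply: (@le_trans _ _ (A + - 2 * eta i * D + eta i ^+ 2 * G ^+ 2)).
  rewrite -pmeanZ -(pmean_cst n (eta i ^+ 2 * G ^+ 2)) -!pmeanD; apply: pmean_le => s.
  rewrite x_step [x s i - _ - T]addrAC (sqr_enormB (x s i - T)) dotvZr (dotvC (x s i - T)) enormZ exprMn.
  rewrite real_normK ?num_real // mulNr mulrA !mulNr lerD2l.
  apply: ler_wpM2l; first exact: sqr_ge0.
  by rewrite lerXn2r ?nnegrE ?enorm_ge0 // gr_le // ltnW.
have e2 : 0 <= 2 * eta i by rewrite mulr_ge0.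
have := ler_wpM2l e2 hD.
have -> : 2 * eta i * (mu / 2 * A - 2 * G ^+ 2 / (mu * n%:R))
  = eta i * mu * A - 4 * G ^+ 2 / mu * (eta i / n%:R) by field; rewrite !gt_eqF.
by lra.
Qed.

(** * Effect of exchanging two positions of the permutation *)

Section Swap.
Context (e E0 : R).
Hypotheses (eta_le : forall j, (j < n)%N -> eta j <= e) (e0 : 0 <= e)
  (E0_ge : (1 + e * L) ^+ n <= E0).

(** Up to step i only position j of the two exchanged ones can have been used. The runs agree before
    it, step j evaluates two different components at the same point and separates the runs by at
    most 2 e G, and each further step expands by at most 1 + e L. *)
Lemma swap_dist (i j : 'I_n) (s : 'S_n) k : (k <= i)%N ->
  enorm (x s k - x (tperm i j * s)%g k)
    <= if (j < k)%N then 2 * e * G * (1 + e * L) ^+ k else 0.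
Proof.
set s' := (tperm i j * s)%g.
have el0 : 0 <= e * L by rewrite mulr_ge0.
elim: k => [|k IH] ki; first by rewrite !x0 subrr enorm0.
have kn : (k < n)%N by exact: ltn_trans (ltn_ord i).
have {}IH := IH (ltnW ki).
have step : k != j :> nat -> enorm (x s k.+1 - x s' k.+1)
    <= (1 + e * L) * enorm (x s k - x s' k).
  move=> kj; rewrite !(x_step _ (Ordinal kn)) /= /s' permM tpermD //; first last.
  - by rewrite -val_eqE eq_sym.
  - by rewrite -val_eqE /= gtn_eqF.
  apply: le_trans (step_lip _ _ _ (eta0 k)) _; apply: ler_wpM2r; first exact: enorm_ge0.
  by rewrite lerD2l ler_wpM2r // eta_le.
have [kj|jk|kj] := ltngtP k j.
- rewrite ltnS leqNgt kj /=; apply: le_trans (step _) _; first by rewrite ltn_eqF.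
  by move: IH; rewrite ltnNge (ltnW kj) /= => /(ler_wpM2l (_ : 0 <= 1 + e * L));
    rewrite mulr0; apply; lra.
- rewrite ltnS (ltnW jk); apply: le_trans (step _) _; first by rewrite gtn_eqF.
  rewrite jk in IH; rewrite exprS mulrCA; apply: ler_wpM2l => //; lra.
- rewrite ltnS -kj leqnn; move: IH; rewrite kj ltnn => IH.
  have xx : x s k = x s' k.
    apply/eqP; rewrite -subr_eq0; apply/eqP/enorm_eq0/eqP.
    by rewrite eq_le enorm_ge0 kj IH.
  rewrite -kj !(x_step _ (Ordinal kn)) /= -xx opprB addrC addrA subrK.
  rewrite -scalerBr enormZ ger0_norm //.
  have g2 := enormB (gr (s' (Ordinal kn)) (x s k)) (gr (s (Ordinal kn)) (x s k)).
  have h1 := gr_le s (s' (Ordinal kn)) (ltnW kn).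
  have h2 := gr_le s (s (Ordinal kn)) (ltnW kn).
  apply: (@le_trans _ _ (e * (2 * G))).
    by apply: ler_pM => //; [exact: enorm_ge0|exact: eta_le|lra].
  rewrite mulrA (mulrC e); apply: ler_peMr; first by rewrite !mulr_ge0.
  by apply: exprn_ege1; lra.
Qed.

Lemma swap_dist_le (i j : 'I_n) (s : 'S_n) :
  enorm (x s i - x (tperm i j * s)%g i) <= 2 * e * G * E0.
Proof.
have el0 : 0 <= e * L by rewrite mulr_ge0.
have eg0 : 0 <= 2 * e * G by rewrite !mulr_ge0.
have E00 : 0 <= E0 by apply: le_trans E0_ge; apply: exprn_ge0; lra.
apply: le_trans (swap_dist j s (leqnn i)) _; case: ifP => _; last exact: mulr_ge0.
apply: ler_wpM2l => //; apply: le_trans E0_ge.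
by apply: ler_weXn2l; [lra|exact: ltnW].
Qed.

(** For every j, exchangeability brings component [s j] to position i, at the price of evaluating it
    at the iterate of the swapped run, which is O(e) away. Averaged over j at the unswapped iterate,
    these components give exactly [gbar]. In contrast with [exchange_position], j ranges over the
    used positions too. *)
Lemma swap_bias (h : 'rV[R]_d) (i : 'I_n) :
  `|pmean (fun s => dotv h (gr (s i) (x s i))) - pmean (fun s => dotv h (gbar (x s i)))|
    <= enorm h * (2 * L * G * E0 * e).
Proof.
set K := enorm h * _.
have -> : pmean (fun s => dotv h (gr (s i) (x s i))) - pmean (fun s => dotv h (gbar (x s i)))
  = n%:R^-1 * \sum_(j < n) pmean (fun s =>
      dotv h (gr (s j) (x (tperm i j * s)%g i) - gr (s j) (x s i))).
  rewrite (eq_pmean (g := fun s => dotv h (gbar (x s i)))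
    (h := fun s => n%:R^-1 * \sum_(j < n) dotv h (gr (s j) (x s i)))); last first.
    move=> s; rewrite -dotv_sumr sum_gr_perm dotvZr mulrA mulVf ?mul1r //.
    by rewrite gt_eqF.
  rewrite pmeanZ pmean_sum.
  have -> : pmean (fun s => dotv h (gr (s i) (x s i)))
    = n%:R^-1 * \sum_(j < n) pmean (fun s => dotv h (gr (s i) (x s i))).
    by rewrite sumr_const card_ord -[X in _ = _ * X]mulr_natl mulKf // gt_eqF.
  rewrite -mulrBr -sumrB; congr (_ * _); apply: eq_bigr => j _.
  rewrite (pmean_reindex (tperm i j)) -pmeanB; apply: eq_pmean => s.
  by rewrite dotvBr permM tpermL.
rewrite normrM ger0_norm ?invr_ge0 // ler_pdivrMl //.
have -> : n%:R * K = \sum_(j < n) K by rewrite sumr_const card_ord mulr_natl.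
apply: le_trans (ler_norm_sum _ _ _) _; apply: ler_sum => j _.
apply: le_trans (pmean_norm _) _; rewrite -(pmean_cst n K); apply: pmean_le => s.
apply: le_trans (normr_dotv _ _) _; apply: ler_wpM2l; first exact: enorm_ge0.
apply: le_trans (gr_lip _ _ _) _; rewrite enormBC.
have -> : 2 * L * G * E0 * e = L * (2 * e * G * E0) by ring.
by apply: ler_wpM2l => //; exact: swap_dist_le.
Qed.

End Swap.

(** * Sharp estimate for an epoch with constant stepsize *)

Section FineEpoch.
Context (e c1 E0 mu rho : R) (J : 'M[R]_d).
Hypotheses (eta_const : forall j, (j < n)%N -> eta j = e) (e_gt0 : 0 < e)
  (e_le : n%:R * e <= c1) (E0_ge : (1 + e * L) ^+ n <= E0)
  (mu0 : 0 < mu) (rho0 : 0 <= rho)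
  (mono : mu * enorm (y - T) ^+ 2 <= dotv (gbar y) (y - T))
  (J_le : forall v, enorm (v *m J) <= L * enorm v)
  (rem_le : forall z, enorm (gbar z - gbar y - (z - y) *m J)
     <= rho * (enorm (z - y) * Num.sqrt (enorm (z - y)) + enorm (z - y) ^+ 2)).

Let e0 : 0 <= e := ltW e_gt0.
Let eta_le j : (j < n)%N -> eta j <= e.
Proof. by move=> jn; rewrite eta_const. Qed.
Let eta_le0 j : (0 <= j < n)%N -> eta j <= e.
Proof. by move=> /andP[_ /eta_le]. Qed.
Let E00 : 0 <= E0.
Proof. exact: E0_ge0 e0 E0_ge. Qed.
Let n1 : 1 <= n%:R :> R.
Proof. by rewrite ler1n. Qed.
Let ne0 : 0 <= n%:R * e.
Proof. by rewrite mulr_ge0. Qed.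
Let c10 : 0 <= c1.
Proof. exact: le_trans e_le. Qed.
Let c_le : n%:R * (e * L) <= c1 * L.
Proof. by rewrite mulrA ler_wpM2r. Qed.

Let u := enorm (y - T).
Let u0 : 0 <= u. Proof. exact: enorm_ge0. Qed.
Let B := Num.sqrt (2 * G ^+ 2 * (1 + (c1 * L) ^+ 2 * E0 ^+ 2)).
Let B0 : 0 <= B. Proof. exact: sqrtr_ge0. Qed.
Let r := Num.sqrt e.
Let r0 : 0 < r. Proof. by rewrite sqrtr_gt0. Qed.
Let r0w : 0 <= r. Proof. exact: sqrtr_ge0. Qed.
Let r2 : r ^+ 2 = e. Proof. by rewrite sqr_sqrtr. Qed.
Let b := noise_drift 0 e E0.
Let a := n%:R * e * L * E0 * u.
Let a0 : 0 <= a. Proof. by rewrite !mulr_ge0. Qed.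
Let Cs := 2 * L * G * E0.
Let Cs0 : 0 <= Cs. Proof. by rewrite /Cs !mulr_ge0. Qed.

Let b0 s i : 0 <= b s i.
Proof. exact: noise_drift_ge0. Qed.

Let sqrtn := Num.sqrt (n%:R : R).
Let sqrtn0 : 0 <= sqrtn. Proof. exact: sqrtr_ge0. Qed.
Let sqrtn2 : sqrtn ^+ 2 = n%:R. Proof. by rewrite sqr_sqrtr. Qed.
Let sqrtn_le : sqrtn <= n%:R.
Proof.
rewrite -sqrtn2 expr2; apply: ler_peMr => //.
by rewrite -(@ler_pXn2r _ 2) ?nnegrE // sqrtn2 expr1n.
Qed.
Let sqrtn_r : sqrtn * r <= 1 + c1.
Proof.
have h : (sqrtn * r) ^+ 2 <= c1 by rewrite exprMn sqrtn2 r2.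
by have := sqr_ge0 (sqrtn * r - 1); nra.
Qed.
Let r_le : r <= 1 + c1.
Proof.
have h : r ^+ 2 <= c1 by rewrite r2; apply: le_trans e_le; apply: ler_peMl.
by have := sqr_ge0 (r - 1); nra.
Qed.

Let Eb2 i : pmean (fun s => b s i ^+ 2) <= B ^+ 2 * (n%:R * e ^+ 2).
Proof.
have := noise_drift_var eta_le0 e0 E0_ge i c_le.
by rewrite /B sqr_sqrtr // mulr_ge0 ?mulr_ge0 ?sqr_ge0 // addr_ge0 ?mulr_ge0 ?sqr_ge0.
Qed.

Let Eb i : pmean (b^~ i) <= B * (sqrtn * e).
Proof.
apply: pmean_le_sqrt; first by rewrite !mulr_ge0.
by rewrite !exprMn sqrtn2; exact: Eb2.
Qed.

Let drift_y s i : (i <= n)%N -> enorm (x s i - y) <= a + b s i.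
Proof.
move=> lin; have := drift eta_le0 e0 E0_ge s (i := i).
by rewrite x0 leq0n lin => /(_ isT).
Qed.

Let dist_T s i : (i <= n)%N -> enorm (x s i - T) <= u + a + b s i.
Proof.
move=> lin; have := enormD (x s i - y) (y - T); rewrite addrA subrK -/u.
by have := drift_y s lin; lra.
Qed.

(** Against a fixed vector the noise averages out: [swap_bias] replaces each gradient by [gbar],
    which is at most L times the distance to [T]. The random size e sqrt n thus enters with an extra
    factor n e. *)
Let mean_drift (h : 'rV[R]_d) i : (i <= n)%N ->
  `|pmean (fun s => dotv h (x s i - y))|
    <= n%:R * e * enorm h * (L * (u + a + B * (sqrtn * e)) + Cs * e).
Proof.
move=> lin; set K := enorm h * (L * (u + a + B * (sqrtn * e)) + Cs * e).
have K0 : 0 <= K by rewrite mulr_ge0 ?enorm_ge0 // !(addr_ge0, mulr_ge0).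
rewrite (eq_pmean (h := fun s => - \sum_(j < n | (0 <= j < i)%N)
    e * dotv h (gr (s j) (x s j)))); last first.
  move=> s; rewrite (x_window s (m := 0) (i := i)) ?lin // x0 addrC addKr.
  rewrite -scaleN1r dotvZr mulN1r; congr (- _); rewrite dotv_sumr.
  by apply: eq_bigr => j _; rewrite dotvZr eta_const.
rewrite pmeanN normrN pmean_sum; apply: le_trans (ler_norm_sum _ _ _) _.
have -> : n%:R * e * enorm h * (L * (u + a + B * (sqrtn * e)) + Cs * e)
  = \sum_(j < n) e * K by rewrite sumr_const card_ord -mulr_natl /K; ring.
rewrite big_mkcond; apply: ler_sum => j _; case: ifP => _; last by rewrite mulr_ge0.
rewrite pmeanZ normrM ger0_norm //; apply: ler_wpM2l => //.
have h1 := swap_bias eta_le e0 E0_ge h j; rewrite -/Cs in h1.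
suff h2 : `|pmean (fun s => dotv h (gbar (x s j)))|
    <= enorm h * (L * (u + a + B * (sqrtn * e))).
  rewrite /K mulrDr; move: h1 h2; set p := pmean _; set q := pmean _ => h1 h2.
  by have := ler_normD (p - q) q; rewrite subrK; lra.
apply: le_trans (pmean_norm _) _.
apply: (@le_trans _ _ (pmean (fun s => enorm h * (L * (u + a)) + enorm h * L * b s j))).
  apply: pmean_le => s; apply: le_trans (normr_dotv _ _) _.
  rewrite -(mulrA _ L) -mulrDr -mulrDr; apply: ler_wpM2l; first exact: enorm_ge0.
  apply: le_trans (gbar_le _) _; apply: ler_wpM2l => //.
  by apply: dist_T; exact: ltnW.
rewrite pmeanD pmean_cst pmeanZ [in leRHS]mulrDr [leRHS]mulrDr lerD2l -!mulrA.
by apply: ler_wpM2l; [exact: enorm_ge0|apply: ler_wpM2l => //; exact: Eb].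
Qed.

Let Cr := 2 * B + 4 * B ^+ 2 + 4 * B ^+ 2 * (1 + c1).
Let Cr0 : 0 <= Cr. Proof. by rewrite !(addr_ge0, mulr_ge0, sqr_ge0). Qed.

Let remainder s i := enorm (gbar (x s i) - gbar y - (x s i - y) *m J).

(* Either the deterministic part a of the drift dominates, and the Lipschitz
   bound suffices, or the random part b does, and the Hoelder bound is used. *)
Let remainder_le s i : (i <= n)%N -> remainder s i
    <= 4 * L * a + rho * (2 * r * b s i + (4 / r + 4) * b s i ^+ 2).
Proof.
move=> lin; have bi := b0 s i; set D := enorm (x s i - y).
have hD : D <= a + b s i by exact: drift_y.
have tail0 : 0 <= 2 * r * b s i + (4 / r + 4) * b s i ^+ 2.
  apply: addr_ge0; first by rewrite !mulr_ge0.
  by apply: mulr_ge0; [rewrite addr_ge0 ?divr_ge0|exact: sqr_ge0].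
have [ba|/ltW ab] := leP (b s i) a.
  apply: (@le_trans _ _ (4 * L * a)); last by rewrite lerDl mulr_ge0.
  apply: le_trans (enormB _ _) _.
  have h1 := gbar_lip (x s i) y; have h2 := J_le (x s i - y).
  rewrite -/D in h1 h2.
  have : L * D <= L * (2 * a) by apply: ler_wpM2l => //; lra.
  by lra.
apply: le_trans (rem_le _) _; rewrite -/D.
apply: (@le_trans _ _ (rho * (2 * r * b s i + (4 / r + 4) * b s i ^+ 2)));
  last by rewrite lerDr !mulr_ge0.
apply: ler_wpM2l => //.
have D0 : 0 <= D by exact: enorm_ge0.
have hD2 : D <= 2 * b s i by lra.
(* Replaces the power 3/2 by moments one and two. The weight r = sqrt e balances them: for D of
   order e sqrt n, r D is of order sqrt n e^(3/2) and D^2 / r of order n e^(3/2). *)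
have hs : D * Num.sqrt D <= r * D + D ^+ 2 / r.
  rewrite -(ler_pM2r r0) mulrDl divfK ?gt_eqF //.
  have s0 := sqrtr_ge0 D; set q := Num.sqrt D in s0 *.
  have q2 : q ^+ 2 = D by rewrite sqr_sqrtr.
  suff : D * (q * r) <= D * (r ^+ 2 + D) by lra.
  by apply: ler_wpM2l => //; rewrite -q2; have := sqr_ge0 (q - r); nra.
have hD3 : D ^+ 2 <= 4 * b s i ^+ 2.
  have -> : 4 * b s i ^+ 2 = (2 * b s i) ^+ 2 by ring.
  by rewrite lerXn2r ?nnegrE // mulr_ge0.
have hD4 : D ^+ 2 / r <= 4 * b s i ^+ 2 / r by rewrite ler_pM2r ?invr_gt0.
have hD5 : r * D <= r * (2 * b s i) by rewrite ler_pM2l.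
have -> : 2 * r * b s i + (4 / r + 4) * b s i ^+ 2
  = r * (2 * b s i) + 4 * b s i ^+ 2 / r + 4 * b s i ^+ 2 by ring.
by lra.
Qed.

Let mean_remainder i : (i <= n)%N ->
  pmean (remainder^~ i) <= 4 * L * a + rho * Cr * (n%:R * r ^+ 3).
Proof.
move=> lin; apply: le_trans (pmean_le (remainder_le ^~ i ^~ lin)) _.
rewrite pmeanD pmean_cst lerD2l pmeanZ -mulrA; apply: ler_wpM2l => //.
rewrite pmeanD !pmeanZ.
have h1 : 2 * r * pmean (b^~ i) <= 2 * B * (n%:R * r ^+ 3).
  apply: (@le_trans _ _ (2 * r * (B * (sqrtn * e)))).
    by apply: ler_wpM2l; [rewrite mulr_ge0|exact: Eb].
  rewrite -r2 [leLHS](_ : _ = 2 * B * r ^+ 3 * sqrtn); last by ring.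
  rewrite [leRHS](_ : _ = 2 * B * r ^+ 3 * n%:R); last by ring.
  by apply: ler_wpM2l => //; rewrite !mulr_ge0 // exprn_ge0.
have h2 : (4 / r + 4) * pmean (fun s => b s i ^+ 2)
    <= (4 * B ^+ 2 + 4 * B ^+ 2 * r) * (n%:R * r ^+ 3).
  apply: (@le_trans _ _ ((4 / r + 4) * (B ^+ 2 * (n%:R * e ^+ 2)))).
    apply: ler_wpM2l; last exact: Eb2.
    by rewrite addr_ge0 // divr_ge0.
  by rewrite -r2 le_eqVlt; apply/orP; left; apply/eqP; field; rewrite gt_eqF.
have h3 : 4 * B ^+ 2 * r * (n%:R * r ^+ 3) <= 4 * B ^+ 2 * (1 + c1) * (n%:R * r ^+ 3).
  apply: ler_wpM2r; first by rewrite mulr_ge0 // exprn_ge0.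
  by apply: ler_wpM2l => //; rewrite mulr_ge0 ?sqr_ge0.
by rewrite /Cr; lra.
Qed.

Let C3 := L ^+ 2 * (1 + c1 * L * E0) + 4 * L ^+ 2 * E0.
Let C4 := L ^+ 2 * B * (1 + c1) + c1 * L * Cs + rho * Cr + Cs.
Let S (s : 'S_n) := \sum_i gr (s i) (x s i).

Let a_le : a <= c1 * L * E0 * u.
Proof.
by apply: ler_wpM2r => //; apply: ler_wpM2r => //; rewrite -mulrA.
Qed.

(** In each term the gradient is replaced by [gbar] (error K3), which is expanded at y. The value at
    y gives mu |u|^2, the linear part is the mean drift tested against [h], the transposed Hessian
    applied to u (error K1), and the Taylor remainder gives K2. *)
Let mean_inner : n%:R * mu * u ^+ 2
    - n%:R * u * (C3 * (n%:R * e) * u + C4 * (e + n%:R * r ^+ 3))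
  <= pmean (fun s => dotv (y - T) (S s)).
Proof.
set h := (y - T) *m J^T.
have hh : enorm h <= L * u by exact: enorm_mulmx_tr.
pose K1 := n%:R * e * (L * u) * (L * (u + a + B * (sqrtn * e)) + Cs * e).
pose K2 := u * (4 * L * a + rho * Cr * (n%:R * r ^+ 3)).
pose K3 := u * (Cs * e).
have term (i : 'I_n) : mu * u ^+ 2 - K1 - K2 - K3
    <= pmean (fun s => dotv (y - T) (gr (s i) (x s i))).
  have h1 := swap_bias eta_le e0 E0_ge (y - T) i; rewrite -/u -/Cs -/K3 in h1.
  have h2 : `|pmean (fun s => dotv h (x s i - y))| <= K1.
    apply: le_trans (mean_drift h (ltnW (ltn_ord i))) _.
    apply: ler_wpM2r; last by apply: ler_wpM2l.
    by rewrite !(addr_ge0, mulr_ge0).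
  have h3 : mu * u ^+ 2 + pmean (fun s => dotv h (x s i - y)) - K2
      <= pmean (fun s => dotv (y - T) (gbar (x s i))).
    apply: (@le_trans _ _ (pmean (fun s => mu * u ^+ 2 + dotv h (x s i - y)
        - u * remainder s i))).
      rewrite pmeanB pmeanD pmean_cst pmeanZ lerD2l lerN2 ler_wpM2l //.
      by apply: mean_remainder; exact: ltnW.
    apply: pmean_le => s; rewrite (dotvC h) -[dotv (x s i - y) h]dotv_mulmx.
    have := normr_dotv (y - T) (gbar (x s i) - gbar y - (x s i - y) *m J).
    rewrite ler_norml => /andP[h3 _]; rewrite !dotvBr -/u in h3.
    have h4 := mono; rewrite -/u (dotvC (gbar y)) in h4.
    by rewrite (dotvC ((x s i - y) *m J)) /remainder; lra.
  move: h1 h2; rewrite !ler_norml => /andP[h1 _] /andP[h2 _]; lra.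
have sum_term : n%:R * (mu * u ^+ 2 - K1 - K2 - K3)
    <= pmean (fun s => dotv (y - T) (S s)).
  rewrite (eq_pmean (h := fun s => \sum_i dotv (y - T) (gr (s i) (x s i)))); last first.
    by move=> s; rewrite dotv_sumr.
  rewrite pmean_sum mulr_natl.
  have -> : (mu * u ^+ 2 - K1 - K2 - K3) *+ n = \sum_(i < n) (mu * u ^+ 2 - K1 - K2 - K3).
    by rewrite sumr_const card_ord.
  exact: ler_sum.
apply: le_trans sum_term; rewrite -!mulrA -mulrBr; apply: ler_wpM2l => //.
suff : K1 + K2 + K3 <= u * (C3 * (n%:R * e) * u + C4 * (e + n%:R * r ^+ 3)) by lra.
have -> : K1 + K2 + K3 = u * (n%:R * e * L * (L * (u + a) + L * B * (sqrtn * e) + Cs * e)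
  + (4 * L * a + rho * Cr * (n%:R * r ^+ 3)) + Cs * e) by rewrite /K1 /K2 /K3; ring.
apply: ler_wpM2l => //.
have nr3 : 0 <= n%:R * r ^+ 3 by rewrite mulr_ge0 // exprn_ge0.
have g1 : n%:R * e * L * (L * (u + a)) <= L ^+ 2 * (1 + c1 * L * E0) * (n%:R * e) * u.
  rewrite [leLHS](_ : _ = n%:R * e * L ^+ 2 * (u + a)); last by ring.
  rewrite [leRHS](_ : _ = n%:R * e * L ^+ 2 * (u + c1 * L * E0 * u)); last by ring.
  by apply: ler_wpM2l; [rewrite mulr_ge0 ?sqr_ge0|rewrite lerD2l].
have g2 : n%:R * e * L * (L * B * (sqrtn * e)) <= L ^+ 2 * B * (1 + c1) * (n%:R * r ^+ 3).
  rewrite -r2 [leLHS](_ : _ = L ^+ 2 * B * (n%:R * r ^+ 3) * (sqrtn * r)); last by ring.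
  rewrite [leRHS](_ : _ = L ^+ 2 * B * (n%:R * r ^+ 3) * (1 + c1)); last by ring.
  by apply: ler_wpM2l => //; rewrite !mulr_ge0 ?sqr_ge0.
have g3 : n%:R * e * L * (Cs * e) <= c1 * L * Cs * e.
  rewrite [leLHS](_ : _ = n%:R * e * (L * Cs * e)); last by ring.
  rewrite [leRHS](_ : _ = c1 * (L * Cs * e)); last by ring.
  by apply: ler_wpM2r => //; rewrite !mulr_ge0.
have g4 : 4 * L * a = 4 * L ^+ 2 * E0 * (n%:R * e) * u by rewrite /a; ring.
have g5 : 0 <= L ^+ 2 * B * (1 + c1) * e + rho * Cr * e.
  by rewrite !(addr_ge0, mulr_ge0, sqr_ge0).
have g6 : 0 <= (c1 * L * Cs + Cs) * (n%:R * r ^+ 3).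
  by rewrite mulr_ge0 // !(addr_ge0, mulr_ge0).
by rewrite /C3 /C4; lra.
Qed.

(** The sum of the gradients is n [gbar y] plus Lipschitz errors in the drift, whose random part is
    bounded in second moment. *)
Let mean_sqr : pmean (fun s => enorm (S s) ^+ 2)
  <= 2 * (n%:R * L * (1 + c1 * L * E0) * u) ^+ 2 + 2 * L ^+ 2 * B ^+ 2 * n%:R ^+ 3 * e ^+ 2.
Proof.
set M := n%:R * L * (1 + c1 * L * E0) * u.
have M0 : 0 <= M by rewrite !(mulr_ge0, addr_ge0).
apply: (@le_trans _ _ (pmean (fun s => 2 * M ^+ 2
    + 2 * L ^+ 2 * n%:R * \sum_(i < n) b s i ^+ 2))); last first.
  rewrite pmeanD pmean_cst pmeanZ lerD2l pmean_sum.
  have : \sum_(i < n) pmean (fun s => b s i ^+ 2) <= \sum_(i < n) B ^+ 2 * (n%:R * e ^+ 2).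
    by apply: ler_sum => i _; exact: Eb2.
  rewrite sumr_const card_ord -[leRHS]mulr_natl => hs.
  have k0 : 0 <= 2 * L ^+ 2 * n%:R by rewrite !mulr_ge0 ?sqr_ge0.
  by have := ler_wpM2l k0 hs; lra.
apply: pmean_le => s.
have h : enorm (S s) <= M + L * \sum_(i < n) b s i.
  have -> : S s = n%:R *: gbar y + \sum_i (gr (s i) (x s i) - gr (s i) y).
    by rewrite -(sum_gr_perm s) sumrB addrC subrK.
  apply: le_trans (enormD _ _) _; rewrite enormZ ger0_norm //.
  have h1 : n%:R * enorm (gbar y) <= n%:R * (L * u) by rewrite ler_wpM2l // gbar_le.
  have h2 : enorm (\sum_i (gr (s i) (x s i) - gr (s i) y))
      <= n%:R * (L * a) + L * \sum_(i < n) b s i.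
    apply: le_trans (enorm_sum _ _ _) _.
    have -> : n%:R * (L * a) = \sum_(i < n) L * a by rewrite sumr_const card_ord mulr_natl.
    rewrite mulr_sumr -big_split; apply: ler_sum => i _ /=.
    apply: le_trans (gr_lip _ _ _) _; rewrite -mulrDr; apply: ler_wpM2l => //.
    by apply: drift_y; exact: ltnW.
  have h3 : n%:R * (L * a) <= n%:R * (L * (c1 * L * E0 * u)).
    by apply: ler_wpM2l => //; apply: ler_wpM2l.
  have -> : M = n%:R * (L * u) + n%:R * (L * (c1 * L * E0 * u)) by rewrite /M; ring.
  by lra.
have := sqr_sum_le (fun i : 'I_n => b s i).
set Q := \sum_(i < n) _ ^+ 2; set W := \sum_(i < n) b s i in h *; rewrite -/W => hW.
have h4 : enorm (S s) ^+ 2 <= (M + L * W) ^+ 2.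
  by rewrite lerXn2r ?nnegrE ?enorm_ge0 // (le_trans (enorm_ge0 _) h).
have h5 : L ^+ 2 * W ^+ 2 <= L ^+ 2 * (n%:R * Q) by rewrite ler_wpM2l ?sqr_ge0.
by have := sqr_ge0 (M - L * W); nra.
Qed.

Let C5 := fine_rate_const L c1 E0.
Let C6 := fine_noise_const L G c1 E0 mu rho.

(** Of the decrease 2 n e mu |u|^2, a quarter pays for the errors quadratic in u, by the smallness
    hypothesis, and a quarter for the errors linear in u, by Young's inequality. The remaining half
    is the stated contraction. *)
Lemma fine_epoch : n%:R * e * fine_rate_const L c1 E0 <= mu / 2 ->
  pmean (fun s => enorm (x s n - T) ^+ 2)
    <= (1 - n%:R * e * mu) * enorm (y - T) ^+ 2
     + fine_noise_const L G c1 E0 mu rho * (n%:R * e ^+ 3 + n%:R ^+ 3 * e ^+ 4).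
Proof.
rewrite -/C5 -/C6 -/u => small.
have -> : pmean (fun s => enorm (x s n - T) ^+ 2)
  = u ^+ 2 + - 2 * e * pmean (fun s => dotv (y - T) (S s))
    + e ^+ 2 * pmean (fun s => enorm (S s) ^+ 2).
  rewrite -!pmeanZ -(pmean_cst n (u ^+ 2)) -!pmeanD; apply: eq_pmean => s.
  rewrite (x_window s (m := 0) (i := n)) ?leqnn // x0.
  rewrite (eq_bigl xpredT) => [|j]; last by rewrite ltn_ord.
  rewrite (eq_bigr (fun j : 'I_n => e *: gr (s j) (x s j))) => [|j _]; last first.
    by rewrite eta_const.
  rewrite -scaler_sumr -/(S s) addrAC (sqr_enormB (y - T)) dotvZr enormZ exprMn.
  by rewrite real_normK ?num_real //; rewrite /u; ring.
have h1 : 2 * e * (n%:R * mu * u ^+ 2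
    - n%:R * u * (C3 * (n%:R * e) * u + C4 * (e + n%:R * r ^+ 3)))
  <= 2 * e * pmean (fun s => dotv (y - T) (S s)) by rewrite ler_pM2l ?mulr_gt0.
have h2 : e ^+ 2 * pmean (fun s => enorm (S s) ^+ 2) <=
    e ^+ 2 * (2 * (n%:R * L * (1 + c1 * L * E0) * u) ^+ 2
      + 2 * L ^+ 2 * B ^+ 2 * n%:R ^+ 3 * e ^+ 2).
  by rewrite ler_wpM2l ?sqr_ge0.
have h3 : n%:R * e * C5 * (n%:R * e * u ^+ 2) <= mu / 2 * (n%:R * e * u ^+ 2).
  by apply: ler_wpM2r => //; rewrite !mulr_ge0 ?sqr_ge0.
(* X^2 is at most 2 C4^2 (e^2 + n^2 e^3), so n e X^2 has the order of the claimed noise. *)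
pose X := C4 * (e + n%:R * r ^+ 3).
have h4 : n%:R * e * (2 * u * X) <= n%:R * e * (mu / 2 * u ^+ 2 + 2 / mu * X ^+ 2).
  apply: ler_wpM2l => //.
  have : 0 <= mu / 2 * (u - 2 / mu * X) ^+ 2 by rewrite mulr_ge0 ?sqr_ge0 // divr_ge0 ?ltW.
  have -> : mu / 2 * (u - 2 / mu * X) ^+ 2
    = mu / 2 * u ^+ 2 + 2 / mu * X ^+ 2 - 2 * u * X by field; rewrite gt_eqF.
  by rewrite subr_ge0.
have h5 : n%:R * e * (2 / mu * X ^+ 2)
    <= 4 / mu * C4 ^+ 2 * (n%:R * e ^+ 3 + n%:R ^+ 3 * e ^+ 4).
  have -> : 4 / mu * C4 ^+ 2 * (n%:R * e ^+ 3 + n%:R ^+ 3 * e ^+ 4)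
    = n%:R * e * (2 / mu * C4 ^+ 2) * (2 * e ^+ 2 + 2 * (n%:R * r ^+ 3) ^+ 2).
    have -> : (n%:R * r ^+ 3) ^+ 2 = n%:R ^+ 2 * e ^+ 3 by rewrite -r2; ring.
    by ring.
  rewrite [leLHS](_ : _ = n%:R * e * (2 / mu * C4 ^+ 2) * (e + n%:R * r ^+ 3) ^+ 2);
    last by rewrite /X; ring.
  apply: ler_wpM2l; first by rewrite mulr_ge0 // mulr_ge0 ?sqr_ge0 // divr_ge0 ?ltW.
  by have := sqr_ge0 (e - n%:R * r ^+ 3); nra.
have h6 : 0 <= 2 * L ^+ 2 * B ^+ 2 * (n%:R * e ^+ 3).
  by rewrite !mulr_ge0 ?sqr_ge0 // exprn_ge0.
have e4 : 2 * e * (n%:R * u * (C3 * (n%:R * e) * u + C4 * (e + n%:R * r ^+ 3)))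
  = 2 * C3 * (n%:R * e) * (n%:R * e * u ^+ 2) + n%:R * e * (2 * u * X) by rewrite /X; ring.
have e5 : e ^+ 2 * (2 * (n%:R * L * (1 + c1 * L * E0) * u) ^+ 2
      + 2 * L ^+ 2 * B ^+ 2 * n%:R ^+ 3 * e ^+ 2)
  = 2 * L ^+ 2 * (1 + c1 * L * E0) ^+ 2 * (n%:R * e) * (n%:R * e * u ^+ 2)
    + 2 * L ^+ 2 * B ^+ 2 * (n%:R ^+ 3 * e ^+ 4) by ring.
have C5E : C5 = 2 * C3 + 2 * L ^+ 2 * (1 + c1 * L * E0) ^+ 2 by [].
have C6E : C6 = 4 / mu * C4 ^+ 2 + 2 * L ^+ 2 * B ^+ 2 by [].
by move: h1 h2 h3 h4 h5 h6; rewrite mulrBr e4 e5 C6E C5E; lra.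
Qed.

End FineEpoch.

End Epoch.

(** * Recursions *)

Section ScalarRecursion.
Context (R : realType).
Implicit Types (z p h x A D M C : R).

(** The left side is at most exp (- 2 z h / (p + h)) and the right side at least exp (- z h / p).
    For h <= p one has h / p <= 2 h / (p + h): this is the purpose of the factor 2 in the
    stepsizes. *)
Lemma contraction_powR z p h : 0 <= z -> 0 < p -> 0 <= h <= p ->
  1 - 2 * z * (h / (p + h)) <= (p / (p + h)) `^ z.
Proof.
move=> z0 p0 /andP[h0 hp]; have P0 : 0 < p + h by lra.
have pP : expR (- (h / p)) <= p / (p + h).
  have -> : p / (p + h) = (1 + h / p)^-1 by field; rewrite !gt_eqF //; lra.
  have hp0 : 0 <= h / p by rewrite divr_ge0 // ltW.
  by rewrite expRN lef_pV2 ?posrE ?expR_gt0 ?expR_ge1Dx //; lra.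
have low : expR (- (h / p) * z) <= (p / (p + h)) `^ z.
  rewrite expRM; apply: ge0_ler_powR => //; rewrite nnegrE ?expR_ge0 //.
  by rewrite divr_ge0 // ltW.
apply: le_trans low; apply: le_trans (expR_ge1Dx _).
have : h / p <= 2 * (h / (p + h)).
  by rewrite mulrA ler_pdivrMr // mulrAC ler_pdivlMr //; nra.
by nra.
Qed.

Lemma bernoulli4 x z : 2 <= z -> 0 <= x -> 1 - 2 * z * x <= (1 - x) ^+ 4.
Proof.
move=> z2 x0; have : (1 - x) ^+ 4 - (1 - 4 * x) = x ^+ 2 * ((x - 2) ^+ 2 + 2) by ring.
have : 0 <= x ^+ 2 * ((x - 2) ^+ 2 + 2) by rewrite mulr_ge0 ?addr_ge0 ?sqr_ge0.
have : 4 * x <= 2 * z * x by rewrite ler_wpM2r //; lra.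
by lra.
Qed.

(** The power of q0 / p is handled by [contraction_powR]. The weight w decays no faster than (1 -
    x)^3 from p to p + h, while [bernoulli4] provides (1 - x)^4; the spare factor 1 - x leaves a
    share x of the new weight for the fresh noise. It serves single steps of the first epoch (h = 1)
    as well as whole later epochs (h = n). *)
Lemma decay_step z q0 p h D M C (w w' A A' : R) :
  2 <= z -> 0 <= q0 -> 0 < p -> 0 <= h <= p -> 0 <= A -> 0 <= D -> 0 <= w -> 0 <= w' ->
  (1 - h / (p + h)) ^+ 3 * w <= w' ->
  A <= M * (D * (q0 / p) `^ z + w) ->
  A' <= (1 - 2 * z * (h / (p + h))) * A + C * (h / (p + h)) * w' ->
  C <= M -> 0 <= M ->
  A' <= M * (D * (q0 / (p + h)) `^ z + w').
Proof.
move=> z2 q00 p0 h_le A0 D0 w0 w'0 hw hA hA' CM M0.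
have /andP[h0 hp] := h_le; have P0 : 0 < p + h by lra.
have z0 : 0 <= z by lra.
set x := h / (p + h) in hw hA' *.
have x0 : 0 <= x by rewrite divr_ge0 // ltW.
have x1 : x <= 1 by rewrite ler_pdivrMr //; lra.
have xc0 : 0 <= 1 - x by rewrite subr_ge0.
have h1 := contraction_powR z0 p0 h_le; rewrite -/x in h1.
have h2 := bernoulli4 z2 x0.
(* The contraction factor can be negative, and is truncated so that inequalities may be multiplied
   by it. *)
pose rp := Num.max 0 (1 - 2 * z * x).
have rp0 : 0 <= rp by rewrite le_max lexx.
have rp1 : rp <= (p / (p + h)) `^ z by rewrite ge_max powR_ge0.
have rp2 : rp <= (1 - x) ^+ 4 by rewrite ge_max exprn_ge0.
have e1 : rp * (q0 / p) `^ z <= (q0 / (p + h)) `^ z.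
  have -> : q0 / (p + h) = (p / (p + h)) * (q0 / p) by field; rewrite !gt_eqF.
  rewrite powRM; [|exact: divr_ge0 (ltW p0) (ltW P0)|exact: divr_ge0 q00 (ltW p0)].
  by apply: ler_wpM2r => //; exact: powR_ge0.
have e2 : rp * w <= (1 - x) * w'.
  apply: (@le_trans _ _ ((1 - x) ^+ 4 * w)); first exact: ler_wpM2r.
  by rewrite exprS -mulrA; apply: ler_wpM2l.
have e3 : (1 - 2 * z * x) * A <= rp * (M * (D * (q0 / p) `^ z + w)).
  apply: (@le_trans _ _ (rp * A)); last exact: ler_wpM2l.
  by apply: ler_wpM2r => //; rewrite le_max lexx orbT.
have e4 : C * x * w' <= M * x * w' 
  by rewrite -(mulrA C) -(mulrA M); exact: ler_wpM2r (mulr_ge0 x0 w'0) _ _ CM.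
have e5 : M * (D * (rp * (q0 / p) `^ z)) <= M * (D * (q0 / (p + h)) `^ z).
  by apply: ler_wpM2l => //; apply: ler_wpM2l.
have e6 : M * (rp * w) <= M * ((1 - x) * w') by apply: ler_wpM2l.
by lra.
Qed.

Lemma powR_shrink z q0 p P (c : R) : 0 <= z -> 0 <= q0 -> 0 < p -> 0 < P -> 0 < c ->
  c * P <= p -> (q0 / p) `^ z <= (c^-1) `^ z * (q0 / P) `^ z.
Proof.
move=> z0 q00 p0 P0 c0 cP.
have c0' := ltW c0; have P0' := ltW P0.
rewrite -powRM ?invr_ge0 ?divr_ge0 //; apply: ge0_ler_powR => //.
- by rewrite nnegrE divr_ge0 // ltW.
- by rewrite nnegrE mulr_ge0 ?invr_ge0 ?divr_ge0.
have -> : c^-1 * (q0 / P) = q0 / (c * P) by field; rewrite !gt_eqF.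
by apply: ler_wpM2l => //; rewrite lef_pV2 ?posrE // mulr_gt0.
Qed.

End ScalarRecursion.

(** * Law of the past permutations *)

Section Histories.
Context (disp : measure_display) (Omega : measurableType disp) (R : realType).
Context (P : probability Omega R) (n : nat) (pi : nat -> Omega -> 'S_n).
Hypothesis pi_iid : iid_uniform_permutations P pi.
Implicit Types (h : seq 'S_n) (g : seq 'S_n -> R) (s : 'S_n).

(* The most recent permutation comes first. *)
Fixpoint hist (k : nat) (w : Omega) : seq 'S_n :=
  if k is k'.+1 then pi k' w :: hist k' w else [::].

(** The latest permutation is averaged first, with the older ones fixed, so that conditioning on the
    past holds by computation. *)
Fixpoint hist_mean (k : nat) g : R :=
  if k is k'.+1 then hist_mean k' (fun h => pmean (fun s => g (s :: h))) else g [::].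

Fixpoint hists (k : nat) : seq (seq 'S_n) :=
  if k is k'.+1 then [seq s :: h | h <- hists k', s <- enum 'S_n] else [:: [::]].

Lemma size_hist k w : size (hist k w) = k.
Proof. by elim: k => //= k ->. Qed.

Lemma size_hists k h : h \in hists k -> size h = k.
Proof.
elim: k h => [h|k IH h /=]; first by rewrite inE => /eqP ->.
by move=> /allpairsP[[h' s] /= [/IH <- _ ->]].
Qed.

Lemma hist_mean_le k g g' : (forall h, size h = k -> g h <= g' h) ->
  hist_mean k g <= hist_mean k g'.
Proof.
elim: k g g' => [|k IH] g g' gg' /=; first exact: gg'.
by apply: IH => h hk; apply: pmean_le => s; apply: gg'; rewrite /= hk.
Qed.

Lemma hist_mean_affine k g (a b : R) :
  hist_mean k (fun h => a * g h + b) = a * hist_mean k g + b.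
Proof.
elim: k g => [//|k IH] g /=; rewrite -IH; congr (hist_mean k _); apply/funext => h.
by rewrite pmeanD pmeanZ pmean_cst.
Qed.

Lemma hist_mean_ge0 k g : (forall h, size h = k -> 0 <= g h) -> 0 <= hist_mean k g.
Proof.
elim: k g => [|k IH] g g0 /=; first exact: g0.
by apply: IH => h hk; apply: pmean_ge0 => s; apply: g0; rewrite /= hk.
Qed.

Lemma hist_meanE k g :
  hist_mean k g = \sum_(h <- hists k) (n`!%:R^-1) ^+ k * g h.
Proof.
elim: k g => [|k IH] g /=; first by rewrite big_seq1 expr0 mul1r.
rewrite IH big_allpairs_dep /=; apply: eq_bigr => h _.
rewrite big_enum /= -mulr_sumr exprSr -mulrA; congr (_ * _).
Qed.

(** A function of the history is a finite combination of indicators, so its expectation needs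
    nothing beyond the law of the history. *)
Lemma hist_indic k g w :
  g (hist k w) = \sum_(h <- hists k) g h * \1_[set v | hist k v = h] w.
Proof.
elim: k g => [|k IH] g /=.
  by rewrite big_seq1 indicE mem_set // mulr1.
rewrite (IH (fun h => g (pi k w :: h))) big_allpairs_dep /=; apply: eq_bigr => h _.
rewrite big_enum /= (bigD1 (pi k w)) //= big1 ?addr0 => [|s sw].
  rewrite !indicE; congr (_ * (_ : bool)%:R).
  by apply/idP/idP => /set_mem /= hh; apply/mem_set => /=; [rewrite hh|case: hh].
rewrite indicE memNset ?mulr0 //= => -[ws _].
by rewrite ws eqxx in sw.
Qed.

Lemma hist_measurable k h : measurable [set w | hist k w = h].
Proof.
have [mpi _ _] := pi_iid.
elim: k h => [|k IH] [|s h] /=.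
- by rewrite (_ : [set _ | _] = setT) //; apply/seteqP; split.
- by rewrite (_ : [set _ | _] = set0) //; apply/seteqP; split.
- by rewrite (_ : [set _ | _] = set0) //; apply/seteqP; split.
rewrite (_ : [set _ | _] = [set w | pi k w = s] `&` [set w | hist k w = h]).
  by apply: measurableI.
by apply/seteqP; split=> w /= [-> ->].
Qed.

Lemma hist_nth k h w : size h = k ->
  hist k w = h <-> forall j, j \in iota 0 k -> pi j w = nth 1%g (rev h) j.
Proof.
elim: k h => [|k IH] [|s h] //= [hk].
have memk j : (j \in 0%N :: iota 1 k) = (j == k) || (j \in iota 0 k).
  by rewrite -[0%N :: _]/(iota 0 k.+1) !mem_iota !add0n /= ltnS leq_eqVlt.
rewrite rev_cons; split.
  move=> [<- /(IH _ hk) hj] j; rewrite memk nth_rcons size_rev hk.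
  case/predU1P => [->|jk]; first by rewrite ltnn eqxx.
  by have := jk; rewrite mem_iota /= add0n => ->; exact: hj.
move=> hj; congr (_ :: _).
  by rewrite hj ?memk ?eqxx // nth_rcons size_rev hk ltnn eqxx.
apply/(IH _ hk) => j jk; rewrite hj ?memk ?jk ?orbT // nth_rcons size_rev hk.
by move: jk; rewrite mem_iota /= add0n => ->.
Qed.

Lemma hist_law k h : size h = k ->
  P [set w | hist k w = h] = ((n`!%:R^-1) ^+ k)%:E.
Proof.
move=> hk; have [_ upi ipi] := pi_iid.
have -> : [set w | hist k w = h] =
    [set w | forall j, j \in iota 0 k -> pi j w \in [set nth 1%g (rev h) j]%SET].
  apply/seteqP; split=> w /=.
    by move/(hist_nth w hk) => hj j jk; rewrite inE hj.
  by move=> hj; apply/(hist_nth w hk) => j jk; apply/set1P; exact: hj.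
rewrite (ipi (iota 0 k) (fun j => [set nth 1%g (rev h) j]%SET)) ?iota_uniq //.
rewrite (eq_bigr (fun=> (n`!%:R^-1)%:E)) => [|j _]; last first.
  rewrite -(upi j (nth 1%g (rev h) j)); congr (P _).
  by apply/seteqP; split=> w /=; [move/set1P|move=> ->; exact/set1P].
by rewrite prodEFin big_const_seq count_predT size_iota iter_mulr_1.
Qed.

(** The event has positive probability, hence is not empty. This allows a representative outcome to
    be chosen for each history, on which the iterates can be read. *)
Lemma hist_realized k h : size h = k -> exists w, hist k w = h.
Proof.
move=> hk; apply: contrapT => noex.
have := hist_law hk; rewrite (_ : [set _ | _] = set0); last first.
  by apply/seteqP; split=> w //= hw; apply: noex; exists w.
rewrite measure0 => -[] /eqP; rewrite eq_sym expf_eq0 invr_eq0 pnatr_eq0.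
by rewrite (gtn_eqF (fact_gt0 n)) andbF.
Qed.

Lemma expectation_hist k g : (forall h, 0 <= g h) ->
  ('E_P[fun w => g (hist k w)] = (hist_mean k g)%:E)%E.
Proof.
move=> g0; rewrite unlock hist_meanE.
under eq_integral => w _ do rewrite hist_indic -sumEFin.
rewrite ge0_integral_sum //; first last.
- by move=> h w _; rewrite lee_fin mulr_ge0.
- move=> h; apply/measurable_EFinP; apply: measurable_funM => //.
  exact: measurable_indic (hist_measurable _ _).
rewrite -sumEFin big_seq [RHS]big_seq; apply: eq_bigr => h /size_hists hk.
rewrite (@integralZl_indic _ _ _ _ _ measurableT (fun=> [set v | hist k v = h])) //.
- rewrite integral_indic ?setIT //; last exact: hist_measurable.
  by rewrite (mulrC _ (g h)) EFinM; congr (_ * _)%E; exact: hist_law.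
- by move=> /lt_geF; rewrite g0.
- exact: hist_measurable.
Qed.

End Histories.

(** * The objective *)

(** The power is at most sqrt t for t <= 1 and at most t for t >= 1. All exponents nu are thereby
    reduced to the endpoints 1/2 and 1. *)
Lemma powR_le_sqrt_add (R : realType) (nu t : R) : 2^-1 <= nu <= 1 -> 0 <= t ->
  t `^ nu <= Num.sqrt t + t.
Proof.
move=> /andP[nu2 nu1]; rewrite le_eqVlt => /predU1P[<-|t0].
  by rewrite powR0 ?sqrtr0 ?addr0 // gt_eqF //; apply: lt_le_trans nu2; rewrite invr_gt0.
have [t1|/ltW t1] := leP t 1.
  rewrite -(powR12_sqrt (ltW t0)); apply: ler_wpDr; first exact: ltW.
  by apply: ger_powR => //; rewrite t0 t1.
by apply: ler_wpDl; [exact: sqrtr_ge0|exact: ler1_powR].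
Qed.

Lemma grad_average (R : realType) (d n : nat) (f : 'I_n -> 'rV[R]_d -> R) z :
  (forall i, differentiable_everywhere (f i)) ->
  grad (average f) z = gbar (fun i => grad (f i)) z.
Proof.
move=> df; apply/rowP => j; rewrite !mxE summxE.
have -> : average f = n%:R^-1 *: \sum_(i < n) f i.
  by apply/funext => u; rewrite /average fctE fct_sumE.
have dfj i : derivable (f i) z (delta_mx ord0 j) by exact/diff_derivable/df.
rewrite deriveZ; last exact: derivable_sum.
by rewrite derive_sum //; congr (_ * _); apply: eq_bigr => i _; rewrite mxE.
Qed.

Section Objective.
Context (R : realType) (d : nat) (F : 'rV[R]_d -> R) (T : 'rV[R]_d) (L mu rho nu : R).
Hypotheses (dF : differentiable_everywhere F) (minT : minimizer F T)
  (F_sc : strongly_convex mu F) (mu0 : 0 < mu).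

(** Sum of the strong convexity inequalities based at z and at [T], where the gradient vanishes. *)
Lemma gradient_monotone z : mu * enorm (z - T) ^+ 2 <= dotv (grad F z) (z - T).
Proof.
have h1 := strongly_convex_grad T (dF z) F_sc.
have h2 := strongly_convex_grad z (dF T) F_sc.
rewrite (minimizer_grad0 (dF T) minT) dotv0l in h2.
by rewrite -(opprB z T) (dotvC (grad F z)) dotvNl (dotvC (z - T)) enormN in h1; lra.
Qed.

Lemma suboptimality_le z : (forall u v, enorm (grad F u - grad F v) <= L * enorm (u - v)) ->
  F z - F T <= L * enorm (z - T) ^+ 2.
Proof.
move=> Flip; have h1 := strongly_convex_grad T (dF z) F_sc.
rewrite -(opprB z T) (dotvC (grad F z)) dotvNl enormN in h1.
have h2 := dotv_le (z - T) (grad F z).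
have h3 := Flip z T; rewrite (minimizer_grad0 (dF T) minT) subr0 in h3.
have h4 := ler_wpM2l (enorm_ge0 (z - T)) h3.
have h5 : 0 <= mu / 2 * enorm (z - T) ^+ 2 by rewrite mulr_ge0 ?sqr_ge0 // divr_ge0 // ltW.
by lra.
Qed.

Lemma holder_remainder y z : 0 <= rho -> 2^-1 <= nu <= 1 ->
  differentiable_everywhere (grad F) -> holder_hessian rho nu F ->
  enorm (grad F z - grad F y - (z - y) *m hessian F y)
    <= rho * (enorm (z - y) * Num.sqrt (enorm (z - y)) + enorm (z - y) ^+ 2).
Proof.
move=> rho0 hnu dG hH; set v := z - y.
have -> : z = y + v by rewrite addrC subrK.
apply: (@le_trans _ _ (rho * enorm v `^ nu * enorm v)).
  apply: taylor_remainder_le => // t /andP[t0 t1].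
  apply: le_trans (hH _ _) _; rewrite addrC addKr; apply: ler_wpM2l => //.
  have nu0 : 0 <= nu by have /andP[] := hnu; lra.
  apply: ge0_ler_powR => //; rewrite ?nnegrE ?enorm_ge0 //.
  by rewrite enormZ ger0_norm // ler_piMl ?enorm_ge0.
rewrite -mulrA; apply: ler_wpM2l => //; rewrite expr2 -mulrDr mulrC.
by apply: ler_wpM2l; [exact: enorm_ge0|exact: powR_le_sqrt_add hnu (enorm_ge0 _)].
Qed.

End Objective.

(** The supremum is a genuine bound because the set of gradient norms is bounded: [X] is bounded in
    the library norm, d copies of which dominate the Euclidean one, and the gradient is
    Lipschitz. *)
Lemma max_grad_norm_ub (R : realType) (d n : nat) (f : 'I_n -> 'rV[R]_d -> R)
    (X : set 'rV[R]_d) (L : R) (T z : 'rV[R]_d) (i : 'I_n) :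
  0 <= L -> lipschitz_grad L (f i) -> compact X -> X T -> X z ->
  enorm (grad (f i) z) <= max_grad_norm f X.
Proof.
move=> L0 flip cX XT Xz.
have [M [_ /(_ (M + 1))]] := compact_bounded cX.
rewrite ltrDl ltr01 => /(_ isT) hM.
have en (v : 'rV[R]_d) : enorm v <= \sum_(j < d) `|v|.
  rewrite [v in enorm v]row_sum_delta; apply: le_trans (enorm_sum _ _ _) _.
  apply: ler_sum => j _; rewrite enormZ.
  have -> : enorm (delta_mx ord0 j : 'rV[R]_d) = 1.
    rewrite enorm_dotv dotvE (bigD1 j) //= big1 => [|k kj].
      by rewrite !mxE !eqxx mulr1 addr0 sqrtr1.
    by rewrite !mxE (negbTE kj) andbF mulr0.
  rewrite mulr1 [leRHS]mx_normrE.
  exact: (le_bigmax _ (fun ij : 'I_1 * 'I_d => `|v ij.1 ij.2|) (ord0, j)).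
apply: (@le_trans _ _ (sup [set enorm (grad (f i) u) | u in X])); last first.
  by rewrite /max_grad_norm (bigD1 i) //= le_max lexx.
apply: ub_le_sup; last by exists z.
exists (enorm (grad (f i) T) + L * (\sum_(j < d) (M + 1) + enorm T)).
move=> _ [u /= Xu <-].
have := enormD (grad (f i) u - grad (f i) T) (grad (f i) T); rewrite subrK => h.
apply: le_trans h _; rewrite addrC lerD2l; apply: le_trans (flip u T) _.
apply: ler_wpM2l => //; apply: le_trans (enormB _ _) _; rewrite lerD2r.
by apply: le_trans (en u) _; apply: ler_sum => j _; exact: hM.
Qed.

(** * Stepsizes and constants *)

Section StepsizeRecursion.
Context (R : realType) (zeta L mu rho G : R).
Hypotheses (zeta4 : 4 < zeta) (mu0 : 0 < mu) (muL : mu <= L) (rho0 : 0 <= rho).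

Definition rr_q0 : R := zeta * (L / mu).

(* The contraction argument of the first epoch covers its first
   warmup_frac * n steps only. *)
Definition warmup_frac : R := mu / (4 * L).

(* Bounds n * eta on every epoch, and on the first one after its warm-up. *)
Definition step_bound : R := 2 * zeta / (mu * warmup_frac).

Definition growth_const : R := expR (step_bound * L).

Definition coarse_const : R :=
  2 * (1 + step_bound * L * growth_const) ^+ 2
  + 4 * G ^+ 2 * (1 + (step_bound * L) ^+ 2 * growth_const ^+ 2).

(** The summand 1 serves the start of the run; the rest is the noise coefficient passed to
    [decay_step]. *)
Definition warmup_const : R :=
  1 + (4 * G ^+ 2 / mu * (2 * zeta / mu) * (rr_q0 + 1) + G ^+ 2 * (2 * zeta / mu) ^+ 2).

Definition first_epoch_const : R :=
  coarse_const * (warmup_const * warmup_frac^-1 `^ zeta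
    + warmup_const * (rr_q0 + 1) ^+ 2 / warmup_frac + step_bound ^+ 2 * (rr_q0 + 1)).

(* From this epoch on, n * eta is small enough for fine_epoch. *)
Definition coarse_epochs : nat :=
  (Num.truncn (4 * zeta * fine_rate_const L step_bound growth_const / mu ^+ 2)).+1.

Definition fine_const : R :=
  fine_noise_const L G step_bound growth_const mu rho
  * ((2 * zeta / mu) ^+ 3 + (2 * zeta / mu) ^+ 4).

(** Loss over one coarse epoch, on which q at most doubles: [2^-1^-1] is 2, in the form given by
    [powR_shrink], and 8 = 2^3 covers the inverse square and cube. The last summand pays for the
    noise. *)
Definition coarse_growth : R :=
  1 + coarse_const * (2^-1^-1 `^ zeta + 8
    + (2 * zeta / mu) ^+ 2 * (rr_q0 + coarse_epochs%:R)).

(** The sum dominates 1 and the constants of the first and of the fine epochs at once; the power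
    allows one loss for each coarse epoch. *)
Definition rr_const : R :=
  (1 + first_epoch_const + fine_const) * coarse_growth ^+ coarse_epochs.

Lemma L_gt0 : 0 < L. Proof. exact: lt_le_trans muL. Qed.

Lemma zeta_gt0 : 0 < zeta. Proof. by have := zeta4; lra. Qed.

Lemma rr_q0_ge : 4 < rr_q0.
Proof.
have k1 : 1 <= L / mu by rewrite ler_pdivlMr // mul1r.
by rewrite /rr_q0; have := zeta4; nra.
Qed.

Lemma warmup_frac_gt0 : 0 < warmup_frac.
Proof. by rewrite divr_gt0 // mulr_gt0 // L_gt0. Qed.

Lemma warmup_frac_le : warmup_frac <= 4^-1.
Proof.
have L0 := L_gt0; rewrite /warmup_frac ler_pdivrMr ?mulr_gt0 //.
by rewrite mulrA mulVf ?mul1r // pnatr_eq0.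
Qed.

Lemma step_bound_gt0 : 0 < step_bound.
Proof.
by apply: divr_gt0; apply: mulr_gt0 => //; [exact: zeta_gt0|exact: warmup_frac_gt0].
Qed.

Lemma growth_const_ge (e : R) (n : nat) : 0 <= e -> n%:R * e <= step_bound ->
  (1 + e * L) ^+ n <= growth_const.
Proof.
move=> e0 ne; have L0 := ltW L_gt0.
apply: (@le_trans _ _ (expR (e * L) ^+ n)).
  by apply: lerXn2r; rewrite ?nnegrE ?expR_ge0 ?expR_ge1Dx // addr_ge0 ?mulr_ge0.
by rewrite -expRM_natl ler_expR mulrA; apply: ler_wpM2r.
Qed.

Lemma coarse_const_ge0 : 0 <= coarse_const.
Proof.
apply: addr_ge0; first by rewrite mulr_ge0 ?sqr_ge0.
by rewrite mulr_ge0 // ?addr_ge0 // mulr_ge0 ?sqr_ge0.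
Qed.

Lemma warmup_const_ge1 : 1 <= warmup_const.
Proof.
have q4 := rr_q0_ge; have z0 := zeta_gt0.
have c0 : 0 <= 2 * zeta / mu by rewrite divr_ge0 ?mulr_ge0 ?(ltW z0) ?(ltW mu0).
have g0 : 0 <= 4 * G ^+ 2 / mu by apply: divr_ge0 (ltW mu0); rewrite mulr_ge0 ?sqr_ge0.
have q1 : 0 <= rr_q0 + 1 by lra.
rewrite lerDl; apply: addr_ge0; first exact: mulr_ge0 (mulr_ge0 g0 c0) q1.
by rewrite mulr_ge0 ?sqr_ge0.
Qed.

Lemma first_epoch_const_ge0 : 0 <= first_epoch_const.
Proof.
have q4 := rr_q0_ge; have w1 := warmup_const_ge1; have f0 := ltW warmup_frac_gt0.
have w0 : 0 <= warmup_const by lra.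
rewrite mulr_ge0 ?coarse_const_ge0 //; apply: addr_ge0; first apply: addr_ge0.
- by rewrite mulr_ge0 ?powR_ge0.
- by apply: divr_ge0 f0; rewrite mulr_ge0 ?sqr_ge0.
- by rewrite mulr_ge0 ?sqr_ge0 //; lra.
Qed.

Lemma fine_noise_const_ge0 :
  0 <= fine_noise_const L G step_bound growth_const mu rho.
Proof.
rewrite /fine_noise_const /=; set B := Num.sqrt _; set K := _ + _ + _.
apply: addr_ge0; apply: mulr_ge0 (sqr_ge0 _); last exact: mulr_ge0 (sqr_ge0 _).
exact: divr_ge0 (ltW mu0).
Qed.

Lemma fine_const_ge0 : 0 <= fine_const.
Proof.
have c0 : 0 <= 2 * zeta / mu by apply: divr_ge0 (ltW mu0); rewrite mulr_ge0 // ltW // zeta_gt0.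
rewrite mulr_ge0 //; last by rewrite addr_ge0 ?exprn_ge0.
exact: fine_noise_const_ge0.
Qed.

Lemma coarse_growth_ge1 : 1 <= coarse_growth.
Proof.
have q4 := rr_q0_ge.
rewrite lerDl mulr_ge0 ?coarse_const_ge0 // !addr_ge0 ?powR_ge0 // mulr_ge0 ?sqr_ge0 //.
by rewrite addr_ge0 //; lra.
Qed.

Lemma rr_const_ge0 : 0 <= rr_const.
Proof.
have f0 := first_epoch_const_ge0; have c0 := fine_const_ge0; have g1 := coarse_growth_ge1.
by rewrite mulr_ge0 ?exprn_ge0 //; lra.
Qed.

(** * Propagation of the bound from epoch to epoch *)

Context (n : nat) (D : R).
Hypotheses (n0 : (0 < n)%N) (D0 : 0 <= D).

Let q := rr_q n rr_q0.

Definition rr_bound (p : R) : R :=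
  D * (rr_q0 / p) `^ zeta + (p ^- 2 + n%:R ^+ 2 * p ^- 3).

Lemma rr_bound_ge0 p : 0 < p -> 0 <= rr_bound p.
Proof.
move=> p0; have p0' := ltW p0.
by rewrite addr_ge0 ?mulr_ge0 ?powR_ge0 ?addr_ge0 ?mulr_ge0 ?invr_ge0 ?exprn_ge0.
Qed.

Let nR : 1 <= n%:R :> R.
Proof. by rewrite ler1n. Qed.

Let qS k : q k.+1 = q k + n%:R.
Proof. by rewrite /q /rr_q mulnS natrD addrAC addrA. Qed.

Let q_ge k : n%:R * k%:R <= q k.
Proof. by rewrite /q /rr_q natrM lerDr; have := rr_q0_ge; lra. Qed.

Lemma rr_q_gt0 k : 0 < q k.
Proof.
have := rr_q0_ge; have := ler0n R (n * k); rewrite /q /rr_q; lra.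
Qed.

Lemma n_le_rr_q k : (0 < k)%N -> n%:R <= q k.
Proof.
move=> k0; apply: le_trans (q_ge k); rewrite ler_peMr //.
by rewrite ler1n.
Qed.

(** From k = 1 on, n <= q_k, so q_{k+1} <= 2 q_k and the old bound loses a constant factor. *)
Lemma coarse_recursion k (M A A' : R) : (0 < k < coarse_epochs)%N -> 1 <= M ->
  A <= M * rr_bound (q k) ->
  A' <= coarse_const * (A + n%:R * (2 * zeta / (mu * q k.+1)) ^+ 2) ->
  A' <= coarse_growth * M * rr_bound (q k.+1).
Proof.
move=> /andP[k0 kK] M1 hA hA'.
have p0 := rr_q_gt0 k; have P0 := rr_q_gt0 k.+1.
have np := n_le_rr_q k0; have q4 := rr_q0_ge; have z0 := zeta_gt0.
have P2 : 2^-1 * q k.+1 <= q k by rewrite qS; lra.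
(* Here the bounded number of coarse epochs matters: it makes n e^2, of order n q^-2, at most a
   constant times n^2 q^-3. *)
have Pn : q k.+1 <= (rr_q0 + coarse_epochs%:R) * n%:R.
  rewrite mulrDl /q /rr_q natrM (mulrC n%:R); apply: lerD; first by rewrite ler_peMr //; lra.
  by apply: ler_wpM2r => //; rewrite ler_nat.
move: Pn P2 p0 P0 hA hA'; set p := q k; set P := q k.+1; set k2 := _ + _%:R.
move=> Pn P2 p0 P0 hA hA'.
have h0 : (rr_q0 / p) `^ zeta <= 2^-1^-1 `^ zeta * (rr_q0 / P) `^ zeta.
  by apply: powR_shrink => //; lra.
have i1 : p^-1 <= 2 * P^-1.
  rewrite -[2 in leRHS]invrK -invfM lef_pV2 ?posrE ?mulr_gt0 //.
have pi0 : 0 <= p^-1 by rewrite invr_ge0 ltW.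
have Pi0 : 0 <= P^-1 by rewrite invr_ge0 ltW.
have h2 : p ^- 2 <= 4 * P ^- 2.
  rewrite -!exprVn (_ : 4 * _ = (2 * P^-1) ^+ 2); last by ring.
  by rewrite lerXn2r ?nnegrE // mulr_ge0.
have h3 : p ^- 3 <= 8 * P ^- 3.
  rewrite -!exprVn (_ : 8 * _ = (2 * P^-1) ^+ 3); last by ring.
  by rewrite lerXn2r ?nnegrE // mulr_ge0.
have h4 : n%:R * (2 * zeta / (mu * P)) ^+ 2
    <= (2 * zeta / mu) ^+ 2 * k2 * (n%:R ^+ 2 * P ^- 3).
  have -> : n%:R * (2 * zeta / (mu * P)) ^+ 2
    = (2 * zeta / mu) ^+ 2 * (n%:R * P ^- 3) * P by field; rewrite !gt_eqF.
  have -> : (2 * zeta / mu) ^+ 2 * k2 * (n%:R ^+ 2 * P ^- 3)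
    = (2 * zeta / mu) ^+ 2 * (n%:R * P ^- 3) * (k2 * n%:R) by ring.
  apply: ler_wpM2l => //; apply: mulr_ge0 (sqr_ge0 _) (mulr_ge0 _ _) => //.
  by rewrite -exprVn exprn_ge0.
set W := P ^- 2 + n%:R ^+ 2 * P ^- 3.
have P20 : 0 <= P ^- 2 by rewrite -exprVn sqr_ge0.
have P30 : 0 <= n%:R ^+ 2 * P ^- 3 by rewrite -exprVn mulr_ge0 ?sqr_ge0 ?exprn_ge0.
have W0 : 0 <= W by rewrite addr_ge0.
have pw0 : 0 <= (rr_q0 / P) `^ zeta by exact: powR_ge0.
set a := 2^-1^-1 `^ zeta in h0 *; have a0 : 0 <= a by exact: powR_ge0.
have b1 : rr_bound p <= (a + 8) * rr_bound P.
  rewrite /rr_bound -/W.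
  have g1 : D * (rr_q0 / p) `^ zeta <= D * (a * (rr_q0 / P) `^ zeta) by apply: ler_wpM2l.
  have g2 : n%:R ^+ 2 * p ^- 3 <= n%:R ^+ 2 * (8 * P ^- 3) by rewrite ler_wpM2l ?sqr_ge0.
  have g3 : 0 <= 8 * (D * (rr_q0 / P) `^ zeta) + a * W by rewrite !addr_ge0 ?mulr_ge0.
  by rewrite /W; rewrite /W in g3; lra.
have b2 : n%:R * (2 * zeta / (mu * P)) ^+ 2 <= (2 * zeta / mu) ^+ 2 * k2 * (M * rr_bound P).
  have k20 : 0 <= (2 * zeta / mu) ^+ 2 * k2.
    by rewrite mulr_ge0 ?sqr_ge0 // /k2 addr_ge0 //; lra.
  apply: le_trans h4 _; apply: ler_wpM2l => //.
  have : 1 * rr_bound P <= M * rr_bound P by apply: ler_wpM2r => //; exact: rr_bound_ge0.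
  have : 0 <= D * (rr_q0 / P) `^ zeta by rewrite mulr_ge0.
  by rewrite {1}/rr_bound; lra.
have cc := coarse_const_ge0.
apply: le_trans hA' _.
have b3 : M * rr_bound p <= M * ((a + 8) * rr_bound P) by apply: ler_wpM2l => //; lra.
have b4 : 0 <= M * rr_bound P by rewrite mulr_ge0 ?rr_bound_ge0 //; lra.
apply: (@le_trans _ _ (coarse_const * ((a + 8 + (2 * zeta / mu) ^+ 2 * k2) * (M * rr_bound P)))).
  by apply: ler_wpM2l => //; lra.
by rewrite /coarse_growth -/a -/k2; lra.
Qed.

Lemma fine_recursion k (M A A' : R) : (0 < k)%N -> 0 <= A -> fine_const <= M ->
  A <= M * rr_bound (q k) ->
  A' <= (1 - n%:R * (2 * zeta / (mu * q k.+1)) * mu) * A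
    + fine_noise_const L G step_bound growth_const mu rho
      * (n%:R * (2 * zeta / (mu * q k.+1)) ^+ 3 + n%:R ^+ 3 * (2 * zeta / (mu * q k.+1)) ^+ 4) ->
  A' <= M * rr_bound (q k.+1).
Proof.
move=> k0 A0 CM hA hA'.
have p0 := rr_q_gt0 k; have P0 := rr_q_gt0 k.+1.
have np := n_le_rr_q k0; have q4 := rr_q0_ge; have z0 := zeta_gt0.
have fc0 := fine_const_ge0.
move: P0 hA'; rewrite /rr_bound qS; move: p0 np hA; rewrite /rr_bound.
set p := q k; set P := p + n%:R => p0 np hA P0 hA'.
have pn : p != 0 by rewrite gt_eqF.
have Pn : P != 0 by rewrite gt_eqF.
have mun : mu != 0 by rewrite gt_eqF.
have pos2 (a : R) : 0 < a -> 0 <= a ^- 2 + n%:R ^+ 2 * a ^- 3.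
  move=> /ltW a0; by rewrite addr_ge0 ?mulr_ge0 ?sqr_ge0 ?invr_ge0 ?exprn_ge0.
have fn0 : 0 <= fine_noise_const L G step_bound growth_const mu rho.
  exact: fine_noise_const_ge0.
apply: (@decay_step R zeta rr_q0 p n%:R D M fine_const
  (p ^- 2 + n%:R ^+ 2 * p ^- 3) (P ^- 2 + n%:R ^+ 2 * P ^- 3) A A') => //; last exact: le_trans fc0 CM.
- by have := zeta4; lra.
- by lra.
- by rewrite ler0n.
- exact: pos2.
- exact: pos2.
- rewrite -/P; have -> : 1 - n%:R / P = p / P by rewrite /P; field.
  have -> : (p / P) ^+ 3 * (p ^- 2 + n%:R ^+ 2 * p ^- 3)
    = P ^- 2 * (p / P) + n%:R ^+ 2 * P ^- 3 by field; rewrite pn Pn.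
  rewrite lerD2r ler_piMr //; first by rewrite -exprVn sqr_ge0.
  by rewrite ler_pdivrMr // mul1r /P lerDl.
apply: le_trans hA' _; rewrite -/P; apply: lerD.
  by rewrite le_eqVlt; apply/orP; left; apply/eqP; field; rewrite mun Pn.
rewrite /fine_const; set F6 := fine_noise_const _ _ _ _ _ _ in fn0 *.
set b := 2 * zeta / mu.
have b0 : 0 <= b by apply: divr_ge0 (ltW mu0); rewrite mulr_ge0 // ltW.
have -> : 2 * zeta / (mu * P) = b / P by rewrite /b; field; rewrite mun Pn.
(* The product contains the two noise terms and two nonnegative cross terms, which are dropped. *)
have -> : F6 * (b ^+ 3 + b ^+ 4) * (n%:R / P) * (P ^- 2 + n%:R ^+ 2 * P ^- 3)
  = F6 * (n%:R * (b / P) ^+ 3 + n%:R ^+ 3 * (b / P) ^+ 4)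
    + F6 * (b ^+ 4 * (n%:R * P ^- 3) + b ^+ 3 * (n%:R ^+ 3 * P ^- 4)).
  by field.
have Pw := ltW P0.
have Pi0 : 0 <= P^-1 by rewrite invr_ge0.
rewrite lerDl; apply: mulr_ge0 => //; rewrite -!exprVn.
apply: addr_ge0; apply: mulr_ge0; try exact: exprn_ge0.
  by apply: mulr_ge0; [exact: ler0n|exact: exprn_ge0].
by apply: mulr_ge0; apply: exprn_ge0.
Qed.

(** q0 + m and q_1 are comparable, because m is within one of a fixed fraction of n. The warm-up
    noise 1/q is turned into n^2 q_1^-3 by q_1 <= (q0 + 1) n. *)
Lemma first_epoch_recursion (B A' : R) : let m := Num.truncn (warmup_frac * n%:R) in
  B <= warmup_const * (D * (rr_q0 / (rr_q0 + m%:R)) `^ zeta + (rr_q0 + m%:R)^-1) ->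
  A' <= coarse_const * (B + n%:R * (2 * zeta / (mu * (rr_q0 + m.+1%:R))) ^+ 2) ->
  A' <= first_epoch_const * rr_bound (q 1).
Proof.
move=> m hB hA'.
have f0 := warmup_frac_gt0; have f4 := warmup_frac_le; have q4 := rr_q0_ge.
have z0 := zeta_gt0; have w1 := warmup_const_ge1; have cc := coarse_const_ge0.
have mS : warmup_frac * n%:R < m.+1%:R by exact: truncnS_gt.
have P0 := rr_q_gt0 1; set P := q 1 in P0 *.
have PE : P = rr_q0 + n%:R by rewrite /P /q /rr_q muln1.
have mS1 : m.+1%:R = m%:R + 1 :> R by rewrite -natr1.
have pP : warmup_frac * P <= rr_q0 + m%:R.
  have : warmup_frac * rr_q0 <= 4^-1 * rr_q0 by rewrite ler_wpM2r //; lra.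
  by rewrite PE mulrDr; lra.
have m0 : 0 <= m%:R :> R by exact: ler0n.
set p := rr_q0 + m%:R in pP hB.
have p0 : 0 < p by rewrite /p; lra.
have Pn : P <= (rr_q0 + 1) * n%:R by rewrite PE mulrDl mul1r lerD2r; apply: ler_peMr => //; lra.
have Pw := ltW P0.
have h0 : (rr_q0 / p) `^ zeta <= warmup_frac^-1 `^ zeta * (rr_q0 / P) `^ zeta.
  by apply: powR_shrink => //; lra.
have h1 : p^-1 <= (rr_q0 + 1) ^+ 2 / warmup_frac * (n%:R ^+ 2 * P ^- 3).
  apply: (@le_trans _ _ ((warmup_frac * P)^-1)).
    by rewrite lef_pV2 ?posrE // mulr_gt0.
  have -> : (warmup_frac * P)^-1 = warmup_frac^-1 * P ^- 3 * P ^+ 2.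
    by field; rewrite !gt_eqF.
  have -> : (rr_q0 + 1) ^+ 2 / warmup_frac * (n%:R ^+ 2 * P ^- 3)
    = warmup_frac^-1 * P ^- 3 * ((rr_q0 + 1) * n%:R) ^+ 2 by ring.
  apply: ler_wpM2l; first by rewrite mulr_ge0 ?invr_ge0 ?exprn_ge0 // ltW.
  by rewrite lerXn2r ?nnegrE // mulr_ge0 //; lra.
have h2 : n%:R * (2 * zeta / (mu * (rr_q0 + m.+1%:R))) ^+ 2
    <= step_bound ^+ 2 * (rr_q0 + 1) * (n%:R ^+ 2 * P ^- 3).
  apply: (@le_trans _ _ (n%:R * (step_bound / P) ^+ 2)).
    apply: ler_wpM2l => //.
    have e0 : 0 < mu * (rr_q0 + m.+1%:R) by rewrite mulr_gt0 //; lra.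
    apply: lerXn2r; rewrite ?nnegrE.
    - by apply: divr_ge0 (ltW e0); rewrite mulr_ge0 // ltW.
    - by apply: divr_ge0 Pw; rewrite ltW // step_bound_gt0.
    have -> : step_bound / P = 2 * zeta / (mu * (warmup_frac * P)).
      by rewrite /step_bound; field; rewrite !gt_eqF.
    apply: ler_wpM2l; first by rewrite mulr_ge0 // ltW.
    have e1 : 0 < mu * (warmup_frac * P) := mulr_gt0 mu0 (mulr_gt0 f0 P0).
    rewrite lef_pV2 ?posrE // ler_pM2l //.
    by rewrite /p in pP; lra.
  have -> : n%:R * (step_bound / P) ^+ 2 = step_bound ^+ 2 * (n%:R * P ^- 3) * P.
    by field; rewrite gt_eqF.
  have -> : step_bound ^+ 2 * (rr_q0 + 1) * (n%:R ^+ 2 * P ^- 3)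
    = step_bound ^+ 2 * (n%:R * P ^- 3) * ((rr_q0 + 1) * n%:R) by ring.
  by apply: ler_wpM2l => //; rewrite mulr_ge0 ?sqr_ge0 // mulr_ge0 ?invr_ge0 ?exprn_ge0.
set a := warmup_frac^-1 `^ zeta in h0 *; have a0 : 0 <= a by exact: powR_ge0.
set b := (rr_q0 + 1) ^+ 2 / warmup_frac in h1 *.
have b0 : 0 <= b by rewrite divr_ge0 ?sqr_ge0 // ltW.
set c := step_bound ^+ 2 * (rr_q0 + 1) in h2 *.
have c0 : 0 <= c by rewrite mulr_ge0 ?sqr_ge0 //; lra.
have Q0 : 0 <= n%:R ^+ 2 * P ^- 3 by rewrite mulr_ge0 ?sqr_ge0 // invr_ge0 exprn_ge0.
have S0 : 0 <= P ^- 2 by rewrite invr_ge0 exprn_ge0.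
have pw0 : 0 <= D * (rr_q0 / P) `^ zeta by rewrite mulr_ge0 ?powR_ge0.
have w0 : 0 <= warmup_const by lra.
apply: le_trans hA' _; rewrite /first_epoch_const -/a -/c -(mulrA coarse_const).
apply: ler_wpM2l => //.
have g1 : B <= warmup_const * (a * (D * (rr_q0 / P) `^ zeta) + b * (n%:R ^+ 2 * P ^- 3)).
  apply: le_trans hB _; apply: ler_wpM2l => //; apply: lerD => //.
  by rewrite mulrCA; apply: ler_wpM2l.
have -> : warmup_const * (rr_q0 + 1) ^+ 2 / warmup_frac = warmup_const * b.
  by rewrite /b mulrA.
have g2 : 0 <= (warmup_const * a) * (P ^- 2 + n%:R ^+ 2 * P ^- 3)
  + (warmup_const * b) * (D * (rr_q0 / P) `^ zeta + P ^- 2)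
  + c * (D * (rr_q0 / P) `^ zeta + P ^- 2).
  have g3 := addr_ge0 S0 Q0; have g4 := addr_ge0 pw0 S0.
  exact: addr_ge0 (addr_ge0 (mulr_ge0 (mulr_ge0 w0 a0) g3)
    (mulr_ge0 (mulr_ge0 w0 b0) g4)) (mulr_ge0 c0 g4).
by rewrite /rr_bound; lra.
Qed.

(** The constant in front of the bound is multiplied by [coarse_growth] at each coarse epoch and
    frozen afterwards, hence the exponent [minn k coarse_epochs]. *)
Lemma rr_recursion (A : nat -> R) : (forall k, 0 <= A k) ->
  A 1%N <= first_epoch_const * rr_bound (q 1) ->
  (forall k, (0 < k)%N ->
    A k.+1 <= coarse_const * (A k + n%:R * (2 * zeta / (mu * q k.+1)) ^+ 2)) ->
  (forall k, (coarse_epochs <= k)%N ->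
    A k.+1 <= (1 - n%:R * (2 * zeta / (mu * q k.+1)) * mu) * A k
    + fine_noise_const L G step_bound growth_const mu rho
      * (n%:R * (2 * zeta / (mu * q k.+1)) ^+ 3 + n%:R ^+ 3 * (2 * zeta / (mu * q k.+1)) ^+ 4)) ->
  forall k, (0 < k)%N -> A k <= rr_const * rr_bound (q k).
Proof.
move=> A0 A1 hc hf.
have g1 := coarse_growth_ge1; have f0 := first_epoch_const_ge0; have c0 := fine_const_ge0.
pose M k := (1 + first_epoch_const + fine_const) * coarse_growth ^+ minn k coarse_epochs.
have Mge k : 1 + first_epoch_const + fine_const <= M k.
  by rewrite /M ler_peMr ?exprn_ege1 //; lra.
have main k : A k.+1 <= M k.+1 * rr_bound (q k.+1).
  elim: k => [|k IH].
    apply: le_trans A1 _; apply: ler_wpM2r; first by apply: rr_bound_ge0; exact: rr_q_gt0.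
    by apply: le_trans (Mge 1%N); lra.
  have [kK|Kk] := ltnP k.+1 coarse_epochs.
    have -> : M k.+2 = coarse_growth * M k.+1.
      by rewrite /M !(minn_idPl _) // 1?ltnW // exprS mulrCA.
    apply: (coarse_recursion (A := A k.+1)) => //; last exact: hc.
    by apply: le_trans (Mge _); lra.
  have -> : M k.+2 = M k.+1 by rewrite /M !(minn_idPr _) // (leq_trans Kk).
  apply: (fine_recursion (A := A k.+1)) => //; last exact: hf.
  by apply: le_trans (Mge _); lra.
case=> // k _; apply: le_trans (main k) _; apply: ler_wpM2r.
  by apply: rr_bound_ge0; exact: rr_q_gt0.
rewrite /rr_const /M; apply: ler_wpM2l; first by lra.
by apply: ler_weXn2l => //; rewrite geq_minr.
Qed.

End StepsizeRecursion.

(** * The run *)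

Section Run.
Context (R : realType) (zeta L mu rho nu G : R).
Hypotheses (zeta4 : 4 < zeta) (mu0 : 0 < mu) (muL : mu <= L)
  (hnu : 2^-1 <= nu <= 1) (rho0 : 0 <= rho).
Context (d n : nat) (f : 'I_n -> 'rV[R]_d -> R) (T y0 : 'rV[R]_d).
Context (disp : measure_display) (Omega : measurableType disp).
Context (P : probability Omega R) (pi : nat -> Omega -> 'S_n).
Context (x : nat -> nat -> Omega -> 'rV[R]_d) (y : nat -> Omega -> 'rV[R]_d).
Context (X : set 'rV[R]_d).
Hypotheses (n0 : (0 < n)%N)
  (df : forall i, differentiable_everywhere (f i))
  (flip : forall i, lipschitz_grad L (f i))
  (F_sc : strongly_convex mu (average f))
  (minT : minimizer (average f) T)
  (F_diff2 : twice_differentiable (average f))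
  (F_holder : holder_hessian rho nu (average f))
  (pi_iid : iid_uniform_permutations P pi)
  (run : rr_run f (rr_step n zeta mu (rr_q0 zeta L mu)) pi y0 x y)
  (cX : compact X) (XT : X T)
  (Xx : forall (k i : nat) (w : Omega), (i <= n)%N -> X (x k i w))
  (GE : G = max_grad_norm f X).

Let F := average f.
Let q0 := rr_q0 zeta L mu.
Let eta := rr_step n zeta mu q0.
Let L0 : 0 < L. Proof. exact: L_gt0 mu0 muL. Qed.
Let z0 : 0 < zeta. Proof. exact: zeta_gt0 zeta4. Qed.
Let q04 : 4 < q0. Proof. exact: rr_q0_ge. Qed.
Let gr i := grad (f i).

Let eta_gt0 k i : 0 < eta k i.
Proof.
have h : 0 < 2 * zeta by rewrite mulr_gt0.
rewrite /eta /rr_step; case: ifP => _; apply: divr_gt0 => //; apply: mulr_gt0 => //.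
  by have := ler0n R i; have := q04; lra.
exact: rr_q_gt0.
Qed.

Let gradF z : grad F z = gbar gr z.
Proof. exact: grad_average. Qed.

Let grT : \sum_i gr i T = 0.
Proof.
by rewrite -(gbarE gr n0) -gradF (minimizer_grad0 (F_diff2.1 T) minT) scaler0.
Qed.

Let gr_le z i : X z -> enorm (gr i z) <= G.
Proof. by move=> Xz; rewrite GE; exact: max_grad_norm_ub (ltW L0) (flip i) cX XT Xz. Qed.

Let mono z : mu * enorm (z - T) ^+ 2 <= dotv (gbar gr z) (z - T).
Proof. by rewrite -gradF; exact: gradient_monotone F_diff2.1 minT F_sc z. Qed.

Let gradF_lip u v : enorm (grad F u - grad F v) <= L * enorm (u - v).
Proof. by rewrite !gradF; exact: gbar_lip. Qed.

Lemma iterates_local k w w' : hist pi k w = hist pi k w' -> y k w = y k w'.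
Proof.
elim: k => [_|k IH /= [hpi /IH hy]].
  by have [-> _ _ _] := run w; have [-> _ _ _] := run w'.
have [_ x0 xS ->] := run w; have [_ x0' xS' ->] := run w'.
have xi i : (i <= n)%N -> x k i w = x k i w'.
  elim: i => [_|i IHi lin]; first by rewrite x0 x0'.
  by rewrite (xS k (Ordinal lin)) (xS' k (Ordinal lin)) /= hpi IHi // ltnW.
exact: xi.
Qed.

Context (W : seq 'S_n -> Omega).
Hypothesis hW : forall h, hist pi (size h) (W h) = h.

Let A k := hist_mean k (fun h => enorm (y k (W h) - T) ^+ 2).
(** The epoch that follows history [h], as a function of its own permutation [s]. Different [s] are
    read at different outcomes; [iterates_local] ensures that they share the starting point. *)
Let path (h : seq 'S_n) (s : 'S_n) (i : nat) := x (size h) i (W (s :: h)).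

Let path_pi h s : pi (size h) (W (s :: h)) = s.
Proof. by have := hW (s :: h) => /= -[]. Qed.

Let path0 h s : path h s 0 = y (size h) (W h).
Proof.
rewrite /path; have [_ -> _ _] := run (W (s :: h)); apply: iterates_local.
by rewrite hW; have := hW (s :: h) => /= -[].
Qed.

Let pathS h s (i : 'I_n) :
  path h s i.+1 = path h s i - eta (size h) i.+1 *: gr (s i) (path h s i).
Proof.
by rewrite /path; have [_ _ xS _] := run (W (s :: h)); rewrite xS path_pi.
Qed.

Let path_n h s : path h s n = y (size h).+1 (W (s :: h)).
Proof. by rewrite /path; have [_ _ _ ->] := run (W (s :: h)). Qed.

Let path_le h s i j : (i <= n)%N -> enorm (gr j (path h s i)) <= G.
Proof. by move=> lin; apply: gr_le; exact: Xx. Qed.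

Let sb := step_bound zeta L mu.
Let E0 := growth_const zeta L mu.

Let coarse h m e : (m <= n)%N ->
  (forall j, (m <= j < n)%N -> eta (size h) j.+1 <= e) -> 0 <= e -> n%:R * e <= sb ->
  pmean (fun s => enorm (y (size h).+1 (W (s :: h)) - T) ^+ 2)
    <= coarse_const zeta L mu G
       * (pmean (fun s => enorm (path h s m - T) ^+ 2) + n%:R * e ^+ 2).
Proof.
move=> mn he e0 ne.
have E0_ge : (1 + e * L) ^+ n <= E0 by exact: growth_const_ge.
have cL : n%:R * (e * L) <= sb * L by rewrite mulrA ler_wpM2r // ltW.
rewrite (eq_pmean (h := fun s => enorm (path h s n - T) ^+ 2)); last first.
  by move=> s; rewrite path_n.
have := coarse_epoch (ltW L0) flip grT (fun i => gr_le i XT)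
  (fun j => ltW (eta_gt0 (size h) j.+1)) (@pathS h) mn he e0 E0_ge cL.
set a := pmean _; set b := pmean _ => hab; apply: le_trans hab _.
have b0 : 0 <= b by apply: pmean_ge0 => s; exact: sqr_ge0.
have e20 : 0 <= n%:R * e ^+ 2 by rewrite mulr_ge0 ?sqr_ge0.
rewrite /coarse_const -/sb -/E0; set u := (1 + _) ^+ 2; set v := 1 + _ * _.
have u0 : 0 <= u by exact: sqr_ge0.
have v0 : 0 <= G ^+ 2 * v by rewrite mulr_ge0 ?sqr_ge0 // addr_ge0 // mulr_ge0 ?sqr_ge0.
have := mulr_ge0 u0 e20; have := mulr_ge0 v0 b0.
by lra.
Qed.

Let q := rr_q n q0.

Let eta_late k i : (0 < k)%N -> eta k i = 2 * zeta / (mu * q k.+1).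
Proof. by case: k. Qed.

Let ne_late k : (0 < k)%N -> n%:R * (2 * zeta / (mu * q k.+1)) <= 2 * zeta / mu / k.+1%:R.
Proof.
move=> k0; have qk : n%:R * k.+1%:R <= q k.+1.
  by rewrite /q /rr_q natrM lerDr ltW //; have := q04; lra.
have qg : 0 < q k.+1 by exact: rr_q_gt0.
have nR : 0 < n%:R :> R by rewrite ltr0n.
have -> : n%:R * (2 * zeta / (mu * q k.+1)) = 2 * zeta / mu * (n%:R / q k.+1).
  by field; rewrite !gt_eqF.
apply: ler_wpM2l; first by apply: divr_ge0 (ltW mu0); rewrite mulr_ge0 // ltW.
by rewrite ler_pdivrMr // mulrC ler_pdivlMr ?ltr0n.
Qed.

Let ne_le_sb k : (0 < k)%N -> n%:R * (2 * zeta / (mu * q k.+1)) <= sb.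
Proof.
move=> k0; apply: le_trans (ne_late k0) _.
have f0 : 0 < warmup_frac L mu by exact: warmup_frac_gt0.
have f1 : warmup_frac L mu <= 4^-1 by exact: warmup_frac_le.
have c0 : 0 <= 2 * zeta / mu by apply: divr_ge0 (ltW mu0); rewrite mulr_ge0 // ltW.
have -> : sb = 2 * zeta / mu * (warmup_frac L mu)^-1.
  by rewrite /sb /step_bound; field; rewrite !gt_eqF.
apply: ler_wpM2l => //; rewrite lef_pV2 ?posrE ?ltr0n //.
by apply: (@le_trans _ _ 1); [lra|rewrite ler1n].
Qed.

Let A_ge0 k : 0 <= A k.
Proof. by apply: hist_mean_ge0 => h _; exact: sqr_ge0. Qed.

Let A_coarse k : (0 < k)%N -> A k.+1 <= coarse_const zeta L mu G
  * (A k + n%:R * (2 * zeta / (mu * q k.+1)) ^+ 2).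
Proof.
move=> k0; set e := 2 * zeta / _; rewrite /A mulrDr -hist_mean_affine /=.
apply: hist_mean_le => h hk; rewrite -mulrDr.
have e0 : 0 <= e by rewrite /e -(eta_late 0 k0) ltW.
have := coarse (h := h) (m := 0) (e := e) (leq0n n).
rewrite hk => /(_ _ e0 (ne_le_sb k0)) hc.
have {hc} := hc (fun j _ => _).
rewrite (eq_pmean (g := fun s => enorm (path h s 0 - T) ^+ 2)
  (h := fun=> enorm (y k (W h) - T) ^+ 2)).
  by rewrite pmean_cst; apply=> j; rewrite eta_late.
by move=> s; rewrite path0 hk.
Qed.

Let A_fine k : (coarse_epochs zeta L mu <= k)%N ->
  A k.+1 <= (1 - n%:R * (2 * zeta / (mu * q k.+1)) * mu) * A k
    + fine_noise_const L G sb E0 mu rho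
      * (n%:R * (2 * zeta / (mu * q k.+1)) ^+ 3 + n%:R ^+ 3 * (2 * zeta / (mu * q k.+1)) ^+ 4).
Proof.
move=> hk; have k0 : (0 < k)%N by exact: leq_trans hk.
have := ne_le_sb k0; have := ne_late k0; have := eta_late 0 k0; have := eta_gt0 k 0.
set e := 2 * zeta / (mu * q k.+1) => e0 ee ne nsb; rewrite ee in e0.
rewrite /A -hist_mean_affine /=; apply: hist_mean_le => h hsize; subst k.
have E0_ge : (1 + e * L) ^+ n <= E0 by apply: growth_const_ge => //; exact: ltW.
rewrite (eq_pmean (h := fun s => enorm (path h s n - T) ^+ 2)); last first.
  by move=> s; rewrite path_n.
have rem z : enorm (gbar gr z - gbar gr (y (size h) (W h))
    - (z - y (size h) (W h)) *m hessian F (y (size h) (W h)))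
  <= rho * (enorm (z - y (size h) (W h)) * Num.sqrt (enorm (z - y (size h) (W h)))
     + enorm (z - y (size h) (W h)) ^+ 2).
  by rewrite -!gradF; exact: holder_remainder F_diff2.2 F_holder.
have J_le v : enorm (v *m hessian F (y (size h) (W h))) <= L * enorm v.
  exact: jacobian_lipschitz F_diff2.2 gradF_lip.
apply: (fine_epoch (ltW L0) flip grT (fun i => gr_le i XT) (@path_le h)
  (fun j => ltW (eta_gt0 (size h) j.+1)) (path0 h) (@pathS h) n0
  _ e0 nsb E0_ge mu0 rho0 (mono _) J_le rem).
  by move=> j _; rewrite eta_late.
set r := fine_rate_const L sb E0.
have hr : 4 * zeta * r / mu ^+ 2 < (size h).+1%:R.
  apply: lt_le_trans (truncnS_gt _) _; rewrite ler_nat; apply: leq_trans hk _.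
  exact: leqnSn.
have sb0 : 0 < sb by exact: step_bound_gt0.
have r0 : 0 <= r.
  have E00 : 0 <= E0 by exact: expR_ge0.
  have LE : 0 <= sb * L * E0 by exact: mulr_ge0 (mulr_ge0 (ltW sb0) (ltW L0)) E00.
  rewrite /r /fine_rate_const; apply: addr_ge0.
    apply: mulr_ge0 => //; apply: addr_ge0.
      by apply: mulr_ge0; [exact: sqr_ge0|exact: addr_ge0].
    by apply: mulr_ge0 E00; apply: mulr_ge0 (sqr_ge0 _).
  by apply: mulr_ge0 (sqr_ge0 _); apply: mulr_ge0 (sqr_ge0 _).
apply: le_trans (ler_wpM2r r0 ne) _.
have k1 : 0 < (size h).+1%:R :> R by rewrite ltr0n.
rewrite mulrAC ler_pdivrMr // mulrAC.
rewrite ltr_pdivrMr ?exprn_gt0 // in hr.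
rewrite ler_pdivrMr //; move: hr; set K := _.+1%:R => hr.
by lra.
Qed.

Let D := enorm (y0 - T) ^+ 2.
Let m := Num.truncn (warmup_frac L mu * n%:R).
Let B i := pmean (fun s => enorm (path [::] s i - T) ^+ 2).

Let path00 s : path [::] s 0 = y0.
Proof. by rewrite path0; have [-> _ _ _] := run (W [::]). Qed.

Let m_le : m%:R <= warmup_frac L mu * n%:R.
Proof.
have f0 : 0 < warmup_frac L mu by exact: warmup_frac_gt0.
by rewrite /m truncn_le mulr_ge0 // ltW.
Qed.

Let m_le4 : m%:R <= n%:R / 4 :> R.
Proof.
apply: le_trans m_le _; rewrite mulrC; apply: ler_wpM2l => //.
exact: warmup_frac_le.
Qed.

Let mn : (m <= n)%N.
Proof.
rewrite -(ler_nat R); apply: le_trans m_le4 _.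
by rewrite ler_pdivrMr // ler_peMr // ler1n.
Qed.

Let warmup i : (i <= m)%N ->
  B i <= warmup_const zeta L mu G * (D * (q0 / (q0 + i%:R)) `^ zeta + (q0 + i%:R)^-1).
Proof.
have w1 : 1 <= warmup_const zeta L mu G by exact: warmup_const_ge1.
have q0p : 0 < q0 by have := q04; lra.
have D0 : 0 <= D by exact: sqr_ge0.
elim: i => [_|i IH im].
  have -> : B 0 = D.
    rewrite /B (eq_pmean (h := fun=> D)) ?pmean_cst // => s.
    by rewrite path00.
  rewrite addr0 divff ?gt_eqF // powR1 mulr1.
  have qi : 0 <= q0^-1 by rewrite invr_ge0 ltW.
  have : 1 * (D + q0^-1) <= warmup_const zeta L mu G * (D + q0^-1).
    by apply: ler_wpM2r => //; exact: addr_ge0.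
  by lra.
have lin : (i < n)%N by exact: leq_trans mn.
have im' : (i <= m)%N by exact: ltnW.
have iR : i%:R <= m%:R :> R by rewrite ler_nat.
have iL : i%:R * L <= n%:R * mu / 4.
  apply: (@le_trans _ _ (warmup_frac L mu * n%:R * L)).
    by apply: ler_wpM2r; [exact: ltW|exact: le_trans m_le].
  by rewrite /warmup_frac le_eqVlt; apply/orP; left; apply/eqP; field; rewrite gt_eqF.
have i2 : i%:R <= n%:R / 2 :> R.
  apply: le_trans iR (le_trans m_le4 _).
  by rewrite ler_pM2l ?ltr0n // lef_pV2 ?posrE // ler_nat.
have := warmup_step flip grT (fun j => gr_le j XT) (@path_le [::])
  (fun j => ltW (eta_gt0 0 j.+1)) path00 (@pathS [::]) n0 (i := Ordinal lin) mu0
  (fun s => mono _) iL i2.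
rewrite -/(B i) -/(B i.+1) /= => hstep.
have i0 : 0 <= i%:R :> R by exact: ler0n.
have nR : 1 <= n%:R :> R by rewrite ler1n.
rewrite -natr1 addrA.
have p0 : 0 < q0 + i%:R by lra.
set p := q0 + i%:R in IH p0 *.
have P0 : 0 < p + 1 by lra.
have etaE : eta 0 i.+1 = 2 * zeta / (mu * (p + 1)).
  by rewrite /eta /rr_step /= -[i.+1%:R]natr1 addrA.
apply: (@decay_step R zeta q0 p 1 D (warmup_const zeta L mu G)
  (4 * G ^+ 2 / mu * (2 * zeta / mu) * (q0 + 1) + G ^+ 2 * (2 * zeta / mu) ^+ 2)
  p^-1 (p + 1)^-1 (B i)) => //.
- by have := zeta4; lra.
- exact: ltW.
- by rewrite ler01 /=; rewrite /p; have := q04; lra.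
- by apply: pmean_ge0 => s; exact: sqr_ge0.
- by rewrite invr_ge0 ltW.
- by rewrite invr_ge0 ltW.
- have -> : (1 - 1 / (p + 1)) ^+ 3 / p = (p + 1)^-1 * (p / (p + 1)) ^+ 2.
    by field; rewrite !gt_eqF.
  apply: ler_piMr; first by rewrite invr_ge0 ltW.
  apply: exprn_ile1; first by rewrite divr_ge0 // ltW.
  by rewrite ler_pdivrMr // mul1r lerDl.
- exact: IH.
- apply: le_trans hstep _; rewrite etaE -[leLHS]addrA; apply: lerD.
    rewrite le_eqVlt; apply/orP; left; apply/eqP; congr (_ * _).
    by field; rewrite !gt_eqF.
  rewrite -[leRHS]mulrA [leRHS]mulrDl; apply: lerD; last first.
    by rewrite le_eqVlt; apply/orP; left; apply/eqP; field; rewrite !gt_eqF.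
  have -> : 4 * G ^+ 2 / mu * (2 * zeta / (mu * (p + 1)) / n%:R)
    = 4 * G ^+ 2 / mu * (2 * zeta / mu) * (p + 1)^-1 * n%:R^-1.
    by field; rewrite !gt_eqF //; lra.
  have -> : 4 * G ^+ 2 / mu * (2 * zeta / mu) * (q0 + 1) * (1 / (p + 1) * (p + 1)^-1)
    = 4 * G ^+ 2 / mu * (2 * zeta / mu) * (p + 1)^-1 * ((q0 + 1) / (p + 1)).
    by field; rewrite !gt_eqF.
  apply: ler_wpM2l.
    apply: mulr_ge0; last by rewrite invr_ge0 ltW.
    apply: mulr_ge0; apply: divr_ge0 (ltW mu0); apply: mulr_ge0 => //.
      exact: sqr_ge0.
    exact: ltW.
  (* 1/n is traded for a multiple of 1/(p + 1), since p + 1 = q0 + i + 1 <= q0 + n <= (q0 + 1) n. *)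
  rewrite ler_pdivlMr // mulrC ler_pdivrMr ?ltr0n //.
  have : i.+1%:R <= n%:R :> R by rewrite ler_nat.
  have : q0 * 1 <= q0 * n%:R by rewrite ler_pM2l.
  by rewrite /p -[i.+1%:R]natr1; lra.
- by rewrite /warmup_const lerDr.
- by lra.
Qed.

Let A_first : A 1 <= first_epoch_const zeta L mu G * rr_bound zeta L mu n D (q 1).
Proof.
have f0 : 0 < warmup_frac L mu by exact: warmup_frac_gt0.
set e := 2 * zeta / (mu * (q0 + m.+1%:R)).
have m0 : 0 <= m.+1%:R :> R by exact: ler0n.
have q04' := q04.
have qm : 0 < q0 + m.+1%:R by lra.
have e0 : 0 <= e by apply: divr_ge0; [rewrite mulr_ge0 // ltW|rewrite mulr_ge0 // ltW].
have he j : (m <= j < n)%N -> eta 0 j.+1 <= e.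
  move=> /andP[mj _]; rewrite /eta /rr_step /= /e; apply: ler_wpM2l.
    by rewrite mulr_ge0 // ltW.
  have jm : m.+1%:R <= j.+1%:R :> R by rewrite ler_nat.
  have qj : 0 < q0 + j.+1%:R by lra.
  by rewrite lef_pV2 ?posrE ?(mulr_gt0 mu0) // ler_pM2l // lerD2l.
have ne : n%:R * e <= sb.
  have -> : sb = 2 * zeta / mu * (warmup_frac L mu)^-1.
    by rewrite /sb /step_bound; field; rewrite !gt_eqF.
  have -> : n%:R * e = 2 * zeta / mu * (n%:R / (q0 + m.+1%:R)).
    by rewrite /e; move: (q0 + _) qm => w w0; field; rewrite !gt_eqF.
  apply: ler_wpM2l; first by apply: divr_ge0 (ltW mu0); rewrite mulr_ge0 // ltW.
  rewrite ler_pdivrMr // ler_pdivlMl //.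
  have : warmup_frac L mu * n%:R < m.+1%:R by exact: truncnS_gt.
  by lra.
have := coarse (h := [::]) mn he e0 ne => hc.
apply: (first_epoch_recursion zeta4 mu0 muL n0 (sqr_ge0 _) (warmup (leqnn m))).
exact: hc.
Qed.

Lemma mean_sqr_dist k : (0 < k)%N ->
  hist_mean k (fun h => enorm (y k (W h) - T) ^+ 2)
    <= rr_const zeta L mu rho G
       * rr_bound zeta L mu n (enorm (y0 - T) ^+ 2) (rr_q n (rr_q0 zeta L mu) k).
Proof.
exact: (rr_recursion zeta4 mu0 muL n0 (sqr_ge0 _) A_ge0 A_first A_coarse A_fine).
Qed.

Lemma expectation_sqr_dist k :
  ('E_P[fun w => (enorm (y k w - T) ^+ 2)%R]
   = (hist_mean k (fun h => enorm (y k (W h) - T) ^+ 2))%:E)%E.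
Proof.
rewrite -(expectation_hist pi_iid); last by move=> h; exact: sqr_ge0.
congr ('E_P[_])%E; apply/funext => w; congr (enorm (_ - _) ^+ 2).
by apply: iterates_local; have := hW (hist pi k w); rewrite size_hist => ->.
Qed.

Lemma expectation_gap k :
  ('E_P[fun w => (average f (y k w) - average f T)%R]
   <= (L * hist_mean k (fun h => enorm (y k (W h) - T) ^+ 2))%:E)%E.
Proof.
pose g h := average f (y k (W h)) - average f T.
have -> : (fun w => average f (y k w) - average f T) = (fun w => g (hist pi k w)).
  apply/funext => w; congr (average f _ - _).
  by apply: iterates_local; have := hW (hist pi k w); rewrite size_hist => ->.
rewrite (expectation_hist pi_iid); last by move=> h; rewrite subr_ge0; exact: minT.
rewrite lee_fin -[leRHS]addr0 -hist_mean_affine; apply: hist_mean_le => h _.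
rewrite addr0; exact: suboptimality_le F_diff2.1 minT F_sc mu0 _ gradF_lip.
Qed.

End Run.

Theorem corollary5p9 (R : realType) (zeta L mu rho nu Gbar : R)
    (hzeta : 4 < zeta) (hmu : 0 < mu) (hmuL : mu <= L)
    (hnu : 2^-1 <= nu <= 1) (hrho : 0 <= rho) :
  let kappa := L / mu in
  let q0 := zeta * kappa in
  exists (C1 : R) (C2 : R -> R),
  forall (d n : nat) (f : 'I_n -> 'rV[R]_d -> R) (xstar y0 : 'rV[R]_d)
    (disp : measure_display) (Omega : measurableType disp)
    (P : probability Omega R) (pi : nat -> Omega -> 'S_n)
    (x : nat -> nat -> Omega -> 'rV[R]_d) (y : nat -> Omega -> 'rV[R]_d)
    (X : set 'rV[R]_d),
  let F := average f in
  let q := rr_q n q0 in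
  (2 <= n)%N ->
  (forall i, convex_function setT (f i)) ->
  (forall i, differentiable_everywhere (f i)) ->
  (forall i, lipschitz_grad L (f i)) ->
  strongly_convex mu F ->
  unique_minimizer F xstar ->
  twice_differentiable F ->
  holder_hessian rho nu F ->
  iid_uniform_permutations P pi ->
  rr_run f (rr_step n zeta mu q0) pi y0 x y ->
  compact X ->
  X xstar ->
  (forall (k i : nat) (w : Omega), (i <= n)%N -> X (x k i w)) ->
  Gbar = max_grad_norm f X ->
  [/\ forall K : nat, (1 <= K)%N ->
        ('E_P[fun w => (enorm (y K w - xstar) ^+ 2)%R] <=
         (C1 * ((q0 / q K) `^ zeta * enorm (y0 - xstar) ^+ 2
                + q K ^- 2 + n%:R ^+ 2 * q K ^- 3))%:E)%E,
      forall K : nat, (1 <= K)%N ->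
        let T : R := (n * K)%:R in
        q0 <= T ->
        ('E_P[fun w => (F (y K w) - F xstar)%R] <=
         (C2 (enorm (y0 - xstar)) * (T ^- 2 + n%:R ^+ 2 * T ^- 3))%:E)%E
    & forall c : R, 0 < c -> c * kappa <= n%:R ->
      forall K : nat, zeta / c <= K%:R ->
        let T : R := (n * K)%:R in
        q0 <= T /\
        ('E_P[fun w => (F (y K w) - F xstar)%R] <=
         (C2 (enorm (y0 - xstar)) * (T ^- 2 + n%:R ^+ 2 * T ^- 3))%:E)%E].
Proof.
move=> kappa q0; set C1 := rr_const zeta L mu rho Gbar.
have z4 : 2 <= zeta by lra.
have q04 : 4 < q0 by exact: rr_q0_ge.
have C10 : 0 <= C1 by exact: rr_const_ge0.
have L0 : 0 < L by exact: lt_le_trans hmuL.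
(* For q0 <= T the factor (q0 / q)^zeta is at most (q0 / q)^2 <= q0^2 T^-2, which explains q0^2 D^2;
   the 1 covers the noise, and L converts squared distance into function gap. *)
exists C1, (fun D => L * C1 * (q0 ^+ 2 * D ^+ 2 + 1)).
move=> d n f xstar y0 disp Omega P pi x y X F q n2 _ df flip F_sc [minT _] F2 FH
  iid run cX XT Xx GE.
have n0 : (0 < n)%N by exact: ltn_trans n2.
have /choice [W hW] : forall h : seq 'S_n, exists w, hist pi (size h) w = h.
  by move=> h; exact: (hist_realized iid (erefl (size h))).
have dist k : (0 < k)%N -> hist_mean k (fun h => enorm (y k (W h) - xstar) ^+ 2)
    <= C1 * rr_bound zeta L mu n (enorm (y0 - xstar) ^+ 2) (q k).
  exact: (mean_sqr_dist hzeta hmu hmuL hnu hrho n0 df flip F_sc minT F2 FH run cX XT Xx GE hW).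
have gap (k : nat) : (1 <= k)%N -> q0 <= (n * k)%:R ->
    ('E_P[fun w => (F (y k w) - F xstar)%R] <=
     (L * C1 * (q0 ^+ 2 * enorm (y0 - xstar) ^+ 2 + 1)
       * ((n * k)%:R ^- 2 + n%:R ^+ 2 * (n * k)%:R ^- 3))%:E)%E.
  move=> k1 qT; apply: le_trans (expectation_gap hmu n0 df flip F_sc minT F2 iid run hW k) _.
  rewrite lee_fin -2!(mulrA L) -(mulrA C1); apply: ler_wpM2l; first exact: ltW.
  apply: le_trans (dist k k1) _; apply: ler_wpM2l => //.
  have qE : q k = q0 + (n * k)%:R by [].
  rewrite /rr_bound qE; move: qT; set T := (n * k)%:R => qT.
  set N := n%:R ^+ 2; set D := enorm _ ^+ 2.
  have D0 : 0 <= D by exact: sqr_ge0.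
  have N0 : 0 <= N by exact: sqr_ge0.
  have T0 : 0 < T by lra.
  have P0 : 0 < q0 + T by lra.
  have i1 : (q0 + T)^-1 <= T^-1 by rewrite lef_pV2 ?posrE //; lra.
  have i0 : 0 <= (q0 + T)^-1 by rewrite invr_ge0 ltW.
  have iT : 0 <= T^-1 by rewrite invr_ge0 ltW.
  have i2 : (q0 + T) ^- 2 <= T ^- 2 by rewrite -!exprVn; apply: lerXn2r.
  have i3 : (q0 + T) ^- 3 <= T ^- 3 by rewrite -!exprVn; apply: lerXn2r.
  have r1 : 0 < q0 / (q0 + T) <= 1.
    by rewrite divr_gt0 //= ?ler_pdivrMr //; lra.
  have pw : (q0 / (q0 + T)) `^ zeta <= q0 ^+ 2 * T ^- 2.
    apply: (@le_trans _ _ ((q0 / (q0 + T)) `^ 2%:R)); first exact: ger_powR.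
    rewrite powR_mulrn; last by have /andP[/ltW] := r1.
    by rewrite expr_div_n; apply: ler_wpM2l => //; exact: sqr_ge0.
  have g1 : D * (q0 / (q0 + T)) `^ zeta <= D * (q0 ^+ 2 * T ^- 2) by apply: ler_wpM2l.
  have g2 : N * (q0 + T) ^- 3 <= N * T ^- 3 by apply: ler_wpM2l.
  have g3 : 0 <= q0 ^+ 2 * D * (N * T ^- 3).
    apply: mulr_ge0 (mulr_ge0 (sqr_ge0 _) D0) (mulr_ge0 N0 _).
    by rewrite -exprVn; exact: exprn_ge0.
  by lra.
split=> [K K1|K K1 T qT|c c0 cn K cK T].
- rewrite (expectation_sqr_dist _ iid run hW) lee_fin.
  apply: le_trans (dist K K1) _; apply: ler_wpM2l => //.
  by rewrite /rr_bound (mulrC (enorm _ ^+ 2)) addrA.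
- exact: gap.
have K0 : 0 < K%:R :> R by apply: lt_le_trans cK; apply: divr_gt0 => //; lra.
(* Multiplying n >= c kappa by K >= zeta / c gives exactly n K >= zeta kappa = q0. *)
have qT : q0 <= T.
  have -> : q0 = c * kappa * (zeta / c) by rewrite /q0; field; rewrite gt_eqF.
  rewrite /T natrM; apply: ler_pM => //.
    by rewrite mulr_ge0 ?divr_ge0 // ltW.
  by apply: divr_ge0; [lra|exact: ltW].
by split=> //; apply: gap => //; rewrite -(ltr0n R).
Qed.
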